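(* Let $\mathfrak g$ be the Lie algebra of a connected semi-simple Lie group. (1) For each integer $n\ge1$, $$\sum_{\text{connected }\mathfrak G}\frac{1}{|\mathrm{Aut}(\mathfrak G)|}\Psi_n(\mathfrak G)\in H^0(\mathcal{GC}^\bullet_{\mathfrak g:n},\delta),$$ i.e. this element of $\mathcal{GC}^0_{\mathfrak g:n}$ is a cocycle of order $n$, where the sum runs over all connected topological trivalent graphs $\mathfrak G$ of order $n$. (2) For each integer $n\ge1$, $$\sum_{\substack{\text{connected }\mathfrak G\\ \text{without self-loops}}}\frac{1}{|\mathrm{Aut}(\mathfrak G)|}\Psi_n(\mathfrak G)\in H^0(\mathcal G^\bullet_{\mathfrak g:n},\delta^\sharp),$$ where the sum runs over all connected topological trivalent graphs $\mathfrak G$ of order $n$ without self-loops.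
   Context: TOPOLOGICAL GRAPHS. A topological trivalent graph $\mathfrak G$ of order $n$ is a set $h(\mathfrak G)$ of $6n$ half-edges with a partition into pairs (edges) and a partition into triples (vertices), up to bijections preserving both partitions. $\mathrm{Aut}(\mathfrak G)$ is the group of permutations of $h(\mathfrak G)$ preserving both partitions. A self-loop is an edge joining a vertex to itself. DECORATED GRAPHS. A connected decorated graph is a finite connected graph $\Gamma$, all vertices of valency $\ge3$, with: numberings of the vertex set $v(\Gamma)$ and of the edge set $e(\Gamma)$; a direction on each edge $e$, from $s(e)$ to $t(e)$, giving half-edges $(s(e),e,+1)$ and $(t(e),e,-1)$; the set $h_\Gamma(i)$ of half-edges at vertex $i$ is ordered by the edge numbering, with $(i,e,+1)$ immediately before $(i,e,-1)$ for a self-loop $e$; at each vertex $i$ of valency $n_i$, a uni-trivalent tree $T_i$ with $n_i$ univalent vertices (leaves) identified with $h_\Gamma(i)$ (so $2n_i-3$ edges) and a cyclic order of the three edges at each trivalent vertex of $T_i$, where at a trivalent vertex adjacent to exactly two leaves $a<b$ with third edge $u$ the cyclic order is $(a,b,u)$, and for $n_i=3$, $T_i$ is the tripod with cyclic order given by the order of $h_\Gamma(i)$. Trees with other cyclic orders are interpreted through the AS relation below. (Each $T_i$ also determines a weight system $\mathfrak g^{\otimes n_i}\to\mathbb R$, which is determined by $T_i$.) Put $\mathrm{ord}(\Gamma)=|e(\Gamma)|-|v(\Gamma)|$, $\deg(\Gamma)=2|e(\Gamma)|-3|v(\Gamma)|\ge0$; degree $0$ means trivalent. COMPLEXES. $\mathcal{GC}_{\mathfrak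 g}$ is the graded commutative $\mathbb Q$-algebra generated by connected decorated graphs modulo: (sign) if $\Gamma,\Gamma'$ have the same underlying graph and differ by an edge renumbering forcing $k$ changes of cyclic orders at vertices of the trees $T_i$ (to keep them compatible with the new order), by $m$ edge direction reversals, the reversals of self-loops forcing $m'$ changes of cyclic orders, and by a permutation of vertex numbers of sign $(-1)^d$, then $\Gamma=(-1)^{k+m+m'+d}\Gamma'$; (AS) reversing the cyclic order at one vertex of one tree $T_i$ changes the sign; (IHX) $\Gamma_I+\Gamma_H+\Gamma_X=0$ for three graphs identical except that in one tree $T_i$, around one inner edge $u$ with the four adjacent branches $1,2,3,4$, the two end vertices of $u$ have cyclic orders $(1,2,u),(3,4,u)$ for $I$; $(1,4,u),(2,3,u)$ for $H$; $(1,3,u),(4,2,u)$ for $X$. The product is disjoint union (numberings of the second graph shifted by those of the first); orders and degrees add. The differential is $\delta\Gamma=\sum_{e}\sigma(i,j)\,\Gamma/e$, over non-self-loop edges $e=(ij)$ from $i$ to $j$, with $\sigma(i,j)=(-1)^j$ if $j>i$ and $(-1)^{i+1}$ if $j<i$; $\Gamma/e$ contracts $e$, the new vertex gets number $\min\{i,j\}$, vertex numbers above $\max\{i,j\}$ and edge numbers above that of $e$ decrease by one, and the new vertex carries the tree obtained by joining $T_i$ and $T_j$ along the leaves corresponding to $e$, with inherited cyclic orders. $\delta$ raises degree by $1$, preserves order, $\delta^2=0$. $\mathcal{GC}^t_{\mathfrak g:n}$ is the part of degree $t$ and order $n$; $\mathcal{GC}^{\prime,t}_{\mathfrak g:n}$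 is the subcomplex spanned by graphs with at least one self-loop; $(\mathcal G^\bullet_{\mathfrak g:n},\delta^\sharp)$ is the quotient complex $\mathcal{GC}^\bullet_{\mathfrak g:n}/\mathcal{GC}^{\prime,\bullet}_{\mathfrak g:n}$, spanned by graphs without self-loops. $H^0$ is the kernel of the differential in degree $0$. THE MAP $\Psi_n$. For a decorated trivalent graph $\Gamma$, the edge orientation of the set of all half-edges lists edges in order, each as $(s(e),e,+1),(t(e),e,-1)$; the vertex orientation lists vertices in order, each as its ordered $h_\Gamma(i)$; $\mathrm{or}_\Gamma\in\{\pm1\}$ is the sign of the permutation taking the first ordering to the second. $\Psi_n(\mathfrak G)=\mathrm{or}_{\Gamma(\mathfrak G)}\cdot\Gamma(\mathfrak G)\in\mathcal{GC}^0_{\mathfrak g:n}$, where $\Gamma(\mathfrak G)$ is any decorated trivalent graph with underlying topological graph $\mathfrak G$ (the result does not depend on the decoration); in (2) its class in $\mathcal G^0_{\mathfrak g:n}$ is meant. *)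

(* Defs.v *)
From HB Require Import structures.
From mathcomp Require Import all_boot all_order all_algebra all_fingroup.
From mathcomp Require Import reals.
From mathcomp Require Import finmap monalg zify.

Set Implicit Arguments.
Unset Strict Implicit.
Unset Printing Implicit Defensive.

Import Order.TTheory GRing.Theory Num.Theory.
Local Open Scope ring_scope.

(* The Lie algebras of connected semi-simple Lie groups are exactly the
   finite-dimensional semi-simple real Lie algebras. *)
Record lieAlgebra (R : realType) := LieAlgebra {
  lie_space :> vectType R;
  lie_br : lie_space -> lie_space -> lie_space;
  lie_brPl : forall a u v w,
    lie_br (a *: u + v) w = a *: lie_br u w + lie_br v w;
  lie_brPr : forall a u v w,
    lie_br w (a *: u + v) = a *: lie_br w u + lie_br w v;
  lie_brxx : forall u, lie_br u u = 0;
  lie_jacobi : forall u v w,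
    lie_br (lie_br u v) w + lie_br (lie_br v w) u + lie_br (lie_br w u) v = 0
}.

Definition lie_derived (R : realType) (g : lieAlgebra R) (U V : {vspace g}) :
    {vspace g} :=
  <<[seq lie_br u v | u <- vbasis U, v <- vbasis V]>>%VS.

Definition lie_ideal (R : realType) (g : lieAlgebra R) (U : {vspace g}) :=
  (lie_derived fullv U <= U)%VS.

Definition lie_solvable (R : realType) (g : lieAlgebra R) (U : {vspace g}) :=
  exists k, iter k (fun V => lie_derived V V) U = 0%VS.

Definition semisimple (R : realType) (g : lieAlgebra R) :=
  forall U : {vspace g}, lie_ideal U -> lie_solvable U -> U = 0%VS.

(* [(e, false)] is the half-edge (s(e),e,+1), [(e, true)] is (t(e),e,-1). *)
Definition halfedge (ne : nat) : finType := ('I_ne * bool)%type.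

(* The order of the half-edges: by edge number, the source half-edge first. *)
Definition hrank ne (h : halfedge ne) : nat := h.1.*2 + h.2.

(* The trees T_i of a graph are recorded together.  [inl (w, r)] is the end
   at the trivalent tree vertex w of the r-th of its three tree edges, where
   the cyclic order at w is 0, 1, 2; [inr h] is the end at the leaf h. *)
Definition flag (ne nt : nat) : finType := ('I_nt * 'I_3 + halfedge ne)%type.

(* [own w] is the vertex i such that w belongs to T_i; [mate] exchanges the two
   ends of each tree edge.  Vertex and edge numbers are the ordinals, so the
   vertex v has the number v.+1. *)
Record gdata (nv ne nt : nat) := GData {
  src : {ffun 'I_ne -> 'I_nv};
  tgt : {ffun 'I_ne -> 'I_nv};
  own : {ffun 'I_nt -> 'I_nv};
  mate : {ffun flag ne nt -> flag ne nt}
}.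

Section GData.
Variables nv ne nt : nat.
Implicit Types (D : gdata nv ne nt) (x y : flag ne nt).

Definition gdata_tuple D := (src D, tgt D, own D, mate D).
Definition tuple_gdata p : gdata nv ne nt := GData p.1.1.1 p.1.1.2 p.1.2 p.2.
Lemma gdata_tupleK : cancel gdata_tuple tuple_gdata. Proof. by case. Qed.
HB.instance Definition _ :=
  Choice.copy (gdata nv ne nt) (can_type gdata_tupleK).

Definition hend D (h : halfedge ne) := if h.2 then tgt D h.1 else src D h.1.

Definition flag_at D x :=
  match x with inl y => own D y.1 | inr h => hend D h end.

Definition tree_adj D : rel (flag ne nt) := fun x y =>
  (mate D x == y) ||
  match x, y with inl a, inl b => a.1 == b.1 | _, _ => false end.

Definition graph_adj D : rel 'I_nv := fun v v' =>
  [exists e, [|| (src D e == v) && (tgt D e == v')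
              | (src D e == v') && (tgt D e == v)]].

Definition valency D v := #|[set h | hend D h == v]|.

(* The graph is connected with valencies at least 3, and the T_i are trees:
   T_i is connected and has one edge less than vertices.  With k_i trivalent
   vertices and n_i leaves there are (3 k_i + n_i) / 2 edges, so the last
   condition amounts to k_i + 2 = n_i. *)
Definition decorated D :=
  [&& (0 < nv)%N,
      [forall v, forall v', connect (graph_adj D) v v'],
      [forall v, (3 <= valency D v)%N],
      [forall x, (mate D x != x) && (mate D (mate D x) == x)],
      [forall x, flag_at D (mate D x) == flag_at D x],
      [forall x, forall y, (flag_at D x == flag_at D y) ==>
         connect (tree_adj D) x y]
    & [forall v, valency D v == #|[set w | own D w == v]| + 2]%N].

(* The requirements on the cyclic orders.  Structures violating them are
   admitted as generators; the AS relation expresses them through the others. *)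
Definition compatible D :=
  (forall w r a b c,
     mate D (inl (w, r)) = inr a -> mate D (inl (w, r + 1)) = inr b ->
     mate D (inl (w, r + 2%:R)) = inl c -> (hrank a < hrank b)%N) /\
  (forall w (a : 'I_3 -> halfedge ne),
     (forall r, mate D (inl (w, r)) = inr (a r)) ->
     exists2 r, (hrank (a r) < hrank (a (r + 1)%R))%N
              & (hrank (a (r + 1)%R) < hrank (a (r + 2%:R)%R))%N).

Definition self_loop D e := src D e == tgt D e.

Definition edge_order : seq (halfedge ne) :=
  [seq (e, b) | e <- enum 'I_ne, b <- [:: false; true]].

Definition vertex_order D : seq (halfedge ne) :=
  flatten [seq [seq h <- edge_order | hend D h == v] | v <- enum 'I_nv].

Lemma edge_order_uniq : uniq edge_order.
Proof. by apply: allpairs_uniq; rewrite ?enum_uniq // => -[? ?] [? ?]. Qed.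

Lemma mem_edge_order h : h \in edge_order.
Proof.
case: h => e b; apply/allpairsP; exists (e, b).
by rewrite /= mem_enum; split=> //; case: b.
Qed.

Lemma vertex_order_perm D : perm_eq (vertex_order D) edge_order.
Proof.
apply/allP => h _ /=; rewrite /vertex_order count_flatten -map_comp sumnE.
rewrite big_map big_enum /= (bigD1 (hend D h)) //= big1 => [|v /negPf hv].
  rewrite addn0 count_filter; apply/eqP/eq_count => k /=.
  by case: eqP => //= ->; rewrite eqxx.
rewrite count_filter; apply/eqP; rewrite -leqn0 leqNgt -has_count.
apply/hasPn => k _ /=; apply/negP => /andP[/eqP-> ].
by rewrite eq_sym hv.
Qed.

Definition order_change D (h : halfedge ne) :=
  nth h (vertex_order D) (index h edge_order).

Lemma order_change_inj D : injective (order_change D).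
Proof.
have szE := perm_size (vertex_order_perm D).
have uV : uniq (vertex_order D).
  by rewrite (perm_uniq (vertex_order_perm D)) edge_order_uniq.
move=> h k; rewrite /order_change.
have ih : (index h edge_order < size (vertex_order D))%N.
  by rewrite szE index_mem mem_edge_order.
have ik : (index k edge_order < size (vertex_order D))%N.
  by rewrite szE index_mem mem_edge_order.
rewrite (set_nth_default h k ik) => /eqP.
rewrite (nth_uniq _ ih ik uV) => /eqP e.
by rewrite -(nth_index h (mem_edge_order h)) e nth_index ?mem_edge_order.
Qed.

Definition or_sign D : rat := (-1) ^+ perm (@order_change_inj D).

End GData.

Section Contraction.
Variables nv ne nt : nat.
Implicit Types (D : gdata nv ne nt).

Definition merge_nat (i j k : nat) : nat :=
  if k == maxn i j then minn i j else if (maxn i j < k)%N then k.-1 else k.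

Lemma merge_lt (i j : 'I_nv) (k : 'I_nv) :
  i != j -> (merge_nat i j k < nv.-1)%N.
Proof.
rewrite -val_eqE /= /merge_nat => /eqP ij.
have := ltn_ord i; have := ltn_ord j; have := ltn_ord k.
by case: eqP; case: (ltnP (maxn i j) k); lia.
Qed.

(* Renumbering of the vertices when i and j are merged. *)
Definition merge (i j : 'I_nv) (ij : i != j) (k : 'I_nv) : 'I_nv.-1 :=
  Ordinal (merge_lt k ij).

Definition flag_emb (e : 'I_ne) (x : flag ne.-1 nt) : flag ne nt :=
  match x with inl y => inl y | inr h => inr (lift e h.1, h.2) end.

(* A left inverse of [flag_emb e], with a dummy value on the ends of e. *)
Definition flag_unemb (e : 'I_ne) (x : flag ne.-1 nt) (y : flag ne nt) :
    flag ne.-1 nt :=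
  match y with
  | inl z => inl z
  | inr h => if unlift e h.1 is Some f then inr (f, h.2) else x
  end.

(* A tree edge ending at a leaf belonging to e is prolonged by the tree edge
   ending at the other leaf belonging to e. *)
Definition flag_join D (e : 'I_ne) (y : flag ne nt) : flag ne nt :=
  match y with
  | inl z => inl z
  | inr h => if h.1 == e then mate D (inr (e, ~~ h.2)) else inr h
  end.

Definition contract D (e : 'I_ne) (he : ~~ self_loop D e) :
    gdata nv.-1 ne.-1 nt :=
  GData [ffun f => merge he (src D (lift e f))]
        [ffun f => merge he (tgt D (lift e f))]
        [ffun w => merge he (own D w)]
        [ffun x => flag_unemb e x (flag_join D e (mate D (flag_emb e x)))].

Section Decorated.
Variables (D : gdata nv ne nt) (e : 'I_ne).
Hypothesis he : ~~ self_loop D e.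
Hypothesis okD : decorated D.

Let C := contract he.
Let vm := merge he.
Let i := src D e.
Let j := tgt D e.

Lemma vmE k k' :
  (vm k == vm k') = [|| k == k', (k == i) && (k' == j) | (k == j) && (k' == i)].
Proof.
move: he; rewrite /vm -val_eqE /= /self_loop /merge_nat -/i -/j.
rewrite -!val_eqE /=.
move: (val k) (val k') (val i) (val j) => {}k {}k' a b /=.
case: (eqVneq k (maxn a b)); case: (eqVneq k' (maxn a b));
  by case: (ltnP (maxn a b) k); case: (ltnP (maxn a b) k'); lia.
Qed.

Lemma vm_surj v' : exists v, vm v = v'.
Proof.
have hv := ltn_ord v'.
have hM : (maxn i j < nv)%N by rewrite gtn_max !ltn_ord.
case: (ltnP v' (maxn i j)) => h.
  have hk : (v' < nv)%N by lia.
  exists (Ordinal hk); apply: val_inj; rewrite /= /merge_nat -/i -/j.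
  by rewrite ltn_eqF // ltnNge (ltnW h).
have hk : (v'.+1 < nv)%N by lia.
exists (Ordinal hk); apply: val_inj; rewrite /= /merge_nat -/i -/j.
by rewrite gtn_eqF ltnS ?h.
Qed.

Lemma mate_neq x : mate D x != x.
Proof. by case/and5P: okD => _ _ _ /forallP/(_ x)/andP[]. Qed.

Lemma mateK x : mate D (mate D x) = x.
Proof. by case/and5P: okD => _ _ _ /forallP/(_ x)/andP[_ /eqP]. Qed.

Lemma mate_at x : flag_at D (mate D x) = flag_at D x.
Proof. by case/and5P: okD => _ _ _ _ /and3P[/forallP/(_ x)/eqP]. Qed.

Definition on_e (x : flag ne nt) := if x is inr h then h.1 == e else false.

Lemma emb_inj : injective (@flag_emb e).
Proof.
move=> [x|[f b]] [y|[f' b']] //= [] // => [-> //|h ->].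
by have /lift_inj -> : lift e f = lift e f' by exact: val_inj.
Qed.

Lemma emb_off x : ~~ on_e (flag_emb e x).
Proof. by case: x => [//|[f b]] /=; rewrite eq_sym neq_lift. Qed.

Lemma emb_unemb x y : ~~ on_e y -> flag_emb e (flag_unemb e x y) = y.
Proof.
case: y => [//|[f b]] /=; case: unliftP => [f' -> //|-> /=].
by rewrite eqxx.
Qed.

Lemma ends_neq b : hend D (e, b) != hend D (e, ~~ b).
Proof. by case: b; rewrite /hend //= eq_sym. Qed.

Lemma join_off y : ~~ on_e (flag_join D e y).
Proof.
case: y => [//|[f b]] /=; case: eqP => [_|/eqP//].
case E: (mate D (inr (e, ~~ b))) => [//|[f' c]] /=; apply/negP => /eqP fe.
rewrite {}fe in E => {f'}; have [cb|cb] := eqVneq c (~~ b).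
  by have := mate_neq (inr (e, ~~ b)); rewrite E cb eqxx.
have {}cb : c = b by move: cb; case: (c); case: (b).
by have := mate_at (inr (e, ~~ b)); rewrite E cb /= => /eqP; rewrite (negPf (ends_neq b)).
Qed.

Lemma join_id y : ~~ on_e y -> flag_join D e y = y.
Proof. by case: y => [//|h] /= /negPf ->. Qed.

Lemma emb_mateC x :
  flag_emb e (mate C x) = flag_join D e (mate D (flag_emb e x)).
Proof. by rewrite ffunE emb_unemb ?join_off. Qed.

Lemma at_C x : flag_at C x = vm (flag_at D (flag_emb e x)).
Proof. by case: x => [y|[f []]] /=; rewrite ?ffunE // /hend /= ffunE. Qed.

Lemma join_mateK y : ~~ on_e y ->
  flag_join D e (mate D (flag_join D e (mate D y))) = y.
Proof.
move=> hy; case E: (mate D y) => [z|[f b]] /=.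
  by rewrite -E mateK join_id.
case: eqP => [fe|_]; last by rewrite -E mateK join_id.
rewrite mateK /= eqxx negbK -fe -E mateK //.
Qed.

Lemma at_join y : vm (flag_at D (flag_join D e y)) = vm (flag_at D y).
Proof.
case: y => [//|[f b]] /=; case: eqP => // ->; rewrite mate_at /=.
by apply/eqP; rewrite vmE; case: b; rewrite /hend /= !eqxx ?orbT.
Qed.

Lemma mate_e_off b : ~~ on_e (mate D (inr (e, b))).
Proof. by have := join_off (inr (e, ~~ b)); rewrite /= eqxx negbK. Qed.

Lemma join_connect z z' : connect (tree_adj D) z z' ->
  forall x x', flag_emb e x = flag_join D e z ->
    flag_emb e x' = flag_join D e z' -> connect (tree_adj C) x x'.
Proof.
have sE x y : flag_emb e (mate C x) = flag_emb e y -> connect (tree_adj C) x y.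
  by move/emb_inj => <-; apply: connect1; rewrite /tree_adj eqxx.
have step u v x y : tree_adj D u v -> flag_emb e x = flag_join D e u ->
    flag_emb e y = flag_join D e v -> connect (tree_adj C) x y.
  case/orP => [/eqP<-|].
    have [ue|ue] := boolP (on_e u).
      case: u ue => [//|[f b]] /= /eqP ->; rewrite eqxx => xE yE.
      apply: sE; rewrite emb_mateC xE mateK /= eqxx negbK yE.
      by rewrite join_id ?mate_e_off.
    by rewrite (join_id ue) => xE yE; apply: sE; rewrite emb_mateC xE yE.
  case: u v => [[w r]|//] [[w' r']|//] /= /eqP ww'.
  case: x => [[w1 r1]|//]; case: y => [[w2 r2]|//] /= [-> _] [-> _].
  by apply: connect1; rewrite /tree_adj /= ww' eqxx orbT.
case/connectP => p; elim: p z => [|u p IH] z /=.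
  move=> _ -> x x' xE x'E; suff -> : x = x' by exact: connect0.
  by apply: emb_inj; rewrite xE x'E.
case/andP=> zu up z'E x x' xE x'E.
have uE : flag_emb e (flag_unemb e x (flag_join D e u)) = flag_join D e u.
  by rewrite emb_unemb ?join_off.
exact: connect_trans (step _ _ _ _ zu xE uE) (IH _ up z'E _ _ uE x'E).
Qed.

Lemma tree_conn x y : flag_at D x = flag_at D y -> connect (tree_adj D) x y.
Proof.
case/and5P: okD => _ _ _ _ /and3P[_ /forallP/(_ x)/forallP/(_ y) + _] xy.
by rewrite xy eqxx.
Qed.

Lemma tree_adj_csym : connect_sym (tree_adj C).
Proof.
apply: sym_connect_sym => x y; rewrite /tree_adj; congr (_ || _).
  by apply/eqP/eqP => <-; apply: emb_inj; rewrite !emb_mateC join_mateK ?emb_off.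
by case: x y => [?|?] [?|?] //=; rewrite eq_sym.
Qed.

Lemma contract_tree_conn x y :
  flag_at C x = flag_at C y -> connect (tree_adj C) x y.
Proof.
have ebC b : flag_emb e (flag_unemb e x (mate D (inr (e, b)))) =
    flag_join D e (inr (e, ~~ b)).
  by rewrite emb_unemb ?mate_e_off //= eqxx negbK.
have bb : connect (tree_adj C) (flag_unemb e x (mate D (inr (e, true))))
                               (flag_unemb e x (mate D (inr (e, false)))).
  apply: connect1; rewrite /tree_adj; apply/orP; left; apply/eqP.
  by apply: emb_inj; rewrite emb_mateC !ebC /= !eqxx mateK /= eqxx.
have main a b : flag_at D (flag_emb e a) = i -> flag_at D (flag_emb e b) = j ->
    connect (tree_adj C) a b.
  move=> ai bj; apply: (connect_trans _ (connect_trans bb _)).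
    apply: (@join_connect (flag_emb e a) (inr (e, false))).
    - by apply: tree_conn; rewrite ai.
    - by rewrite join_id ?emb_off.
    - by rewrite ebC.
  apply: (@join_connect (inr (e, true)) (flag_emb e b)).
  - by apply: tree_conn; rewrite bj.
  - by rewrite ebC.
  - by rewrite join_id ?emb_off.
rewrite !at_C => /eqP; rewrite vmE => /or3P[/eqP h|/andP[/eqP xi /eqP yj]|].
- apply: (join_connect (tree_conn h)); by rewrite join_id ?emb_off.
- exact: main.
- by case/andP=> /eqP xj /eqP yi; rewrite tree_adj_csym; apply: main.
Qed.

Lemma contract_conn v v' : connect (graph_adj C) v v'.
Proof.
have [u <-] := vm_surj v; have [u' <-] := vm_surj v'.
have : connect (graph_adj D) u u'.
  by case/and5P: okD => _ /forallP/(_ u)/forallP/(_ u').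
case/connectP => p; elim: p u => [|w p IH] u /= => [_ -> //|].
case/andP=> /existsP[f uw] wp u'E.
apply: connect_trans (IH _ wp u'E).
case: (unliftP e f) uw => [f' ->|->] uw.
  apply: connect1; apply/existsP; exists f'; rewrite /= !ffunE.
  by case/orP: uw => /andP[/eqP-> /eqP->]; rewrite !eqxx ?orbT.
suff -> : vm u = vm w by exact: connect0.
by apply/eqP; rewrite vmE; case/orP: uw => /andP[/eqP<- /eqP<-];
  rewrite !eqxx ?orbT.
Qed.

Lemma card_fibre v' : #|[set v | vm v == v']| = (1 + (v' == vm i))%N.
Proof.
have [->|nv'] := eqVneq v' (vm i).
  rewrite -[RHS]/(true.+1) -[true](he : (i != j) = true) -cards2.
  apply: eq_card => v; rewrite !inE vmE [RHS]orbC; case: (v == i) => /=.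
    by rewrite orbT.
  by rewrite orbF eqxx andbT.
have [u vu] := vm_surj v'; rewrite addn0 -(cards1 u); apply: eq_card => v.
rewrite !inE; move: nv'; rewrite -vu !vmE -/i -/j => /norP[ui /norP[_ uj]].
rewrite eqxx !andbT -/i -/j in uj ui *; rewrite (negPf ui) (negPf uj).
by rewrite !andbF !orbF.
Qed.

Lemma card_half_sum m (P : pred (halfedge m)) :
  #|[set h | P h]| = (\sum_(f < m) (P (f, false) + P (f, true)))%N.
Proof.
rewrite -sum1dep_card big_mkcond /=.
transitivity (\sum_(f < m) \sum_(b : bool) P (f, b))%N.
  by rewrite pair_bigA; apply: eq_bigr => -[f b] _ /=; case: (P _).
by apply: eq_bigr => f _; rewrite big_bool addnC.
Qed.

Lemma card_pull n1 n2 (T : finType) (own1 : T -> 'I_n1) (f : 'I_n1 -> 'I_n2) v' :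
  (#|[set x | f (own1 x) == v']| =
   \sum_(v in [set v | f v == v']) #|[set x | own1 x == v]|)%N.
Proof.
rewrite -sum1dep_card (partition_big own1 [pred v | f v == v']) //=.
apply: eq_big => v; first by rewrite inE.
move=> /eqP fv; rewrite -sum1dep_card; apply: eq_bigl => x.
by have [->|] := eqVneq (own1 x) v; rewrite ?fv ?eqxx ?andbT ?andbF.
Qed.

Lemma contract_valency v' :
  (valency C v' + (v' == vm i).*2)%N = #|[set h | vm (hend D h) == v']|.
Proof.
rewrite /valency !card_half_sum (bigD1_ord e) //= addnC; congr (_ + _)%N.
  rewrite /hend /= -/i -/j; have -> : vm j = vm i.
    by apply/eqP; rewrite vmE !eqxx !orbT.
  by rewrite addnn eq_sym.
by apply: eq_bigr => f _; rewrite /hend /= !ffunE.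
Qed.

Lemma decorated_contract : decorated C.
Proof.
case/and5P: (okD) => _ _ /forallP val3 _ /and3P[_ _ /forallP cnt].
have S3 : forall v', (\sum_(v in [set v | vm v == v']) 3 <=
                 #|[set h | vm (hend D h) == v']|)%N.
  by move=> v'; rewrite card_pull; apply: leq_sum => v _; apply: val3.
have SN : forall v', (#|[set h | vm (hend D h) == v']| =
    #|[set w | vm (own D w) == v']| + \sum_(v in [set v | vm v == v']) 2)%N.
  move=> v'; rewrite !card_pull -big_split /=; apply: eq_bigr => v _.
  exact/eqP/cnt.
apply/and5P; split.
- exact: leq_ltn_trans (leq0n _) (ltn_ord (vm i)).
- by apply/forallP => v; apply/forallP => v'; apply: contract_conn.
- apply/forallP => v'; have := S3 v'.
  by rewrite -contract_valency sum_nat_const card_fibre; case: eqP => _ /=; lia.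
- apply/forallP => x; apply/andP; split.
    apply/eqP => /(congr1 (flag_emb e)); rewrite emb_mateC.
    case E: (mate D (flag_emb e x)) => [z|[f b]] /=.
      by rewrite -E; apply/eqP/mate_neq.
    case: eqP => [fe|_]; last by rewrite -E; apply/eqP/mate_neq.
    rewrite -[RHS]mateK E fe => /(can_inj mateK) [].
    by case: b {E}.
  by apply/eqP/emb_inj; rewrite !emb_mateC join_mateK ?emb_off.
- apply/and3P; split.
  + by apply/forallP => x; rewrite !at_C emb_mateC at_join mate_at.
  + apply/forallP => x; apply/forallP => y; apply/implyP => /eqP.
    exact: contract_tree_conn.
  + apply/forallP => v'; have := SN v'; rewrite -contract_valency.
    rewrite sum_nat_const card_fibre.
    have -> : #|[set w | vm (own D w) == v']| = #|[set w | own C w == v']|.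
      by apply: eq_card => w; rewrite !inE ffunE.
    by case: eqP => _ /=; lia.
Qed.

End Decorated.
End Contraction.

(* The relations defining the complex of g do not involve g: the weight systems
   on g that decorate the vertices are determined by the trees T_i, so they are
   not recorded and g is only an index. *)
Definition dgraph (R : realType) (g : lieAlgebra R) :=
  {G : {s : nat * nat * nat & gdata s.1.1 s.1.2 s.2} | decorated (tagged G)}.
HB.instance Definition _ (R : realType) (g : lieAlgebra R) :=
  Choice.on (dgraph g).

Section DGraph.
Variables (R : realType) (g : lieAlgebra R).
Implicit Types (G : dgraph g).

Definition DGraph nv ne nt (D : gdata nv ne nt) (okD : decorated D) : dgraph g :=
  exist _ (existT (fun s => gdata s.1.1 s.1.2 s.2) (nv, ne, nt) D) okD.

Definition dg_nv G := (tag (val G)).1.1.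
Definition dg_ne G := (tag (val G)).1.2.
Definition dg_nt G := (tag (val G)).2.
Definition dg_data G : gdata (dg_nv G) (dg_ne G) (dg_nt G) := tagged (val G).
Definition dg_ok G : decorated (dg_data G) := valP G.

Definition dg_ord G : int := (dg_ne G)%:Z - (dg_nv G)%:Z.
Definition dg_deg G : int := 2 * (dg_ne G)%:Z - 3 * (dg_nv G)%:Z.
Definition dg_has_loop G : bool := [exists e, self_loop (dg_data G) e].

(* The free associative algebra on the connected decorated graphs: the word
   G1 ... Gk stands for the disjoint union of G1, ..., Gk. *)
Definition GCfree := {malg rat[{fmonom dgraph g}]}.

Definition gc_gen G : GCfree := mkmalgU (fmu G) 1.

Definition word_ord (m : {fmonom dgraph g}) : int :=
  \sum_(G <- fmonom_val m) dg_ord G.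
Definition word_deg (m : {fmonom dgraph g}) : int :=
  \sum_(G <- fmonom_val m) dg_deg G.
Definition word_has_loop (m : {fmonom dgraph g}) : bool :=
  has dg_has_loop (fmonom_val m).

(* D' is obtained from D by applying tau to the vertex numbers and pi to the
   edge numbers, by reversing the edges e with [eps e], and by identifying the
   trees through nu and rho; the cyclic order at the tree vertex w is reversed
   when [rho w] is odd. *)
Definition relabelled nv ne nt (D D' : gdata nv ne nt)
    (tau : 'S_nv) (pi : 'S_ne) (eps : {ffun 'I_ne -> bool})
    (nu : 'S_nt) (rho : {ffun 'I_nt -> 'S_3}) : Prop :=
  let phi (x : flag ne nt) : flag ne nt :=
    match x with
    | inl y => inl (nu y.1, rho y.1 y.2)
    | inr h => inr (pi h.1, h.2 (+) eps h.1)
    end in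
  forall x, flag_at D' (phi x) = tau (flag_at D x) /\
            mate D' (phi x) = phi (mate D x).

(* The trees of D with the edge ends moved by q. *)
Definition reglue nv ne nt (D : gdata nv ne nt) (q : {perm flag ne nt}) :
    gdata nv ne nt :=
  GData (src D) (tgt D) (own D) [ffun x => q (mate D ((q^-1)%g x))].

(* In [rel_sign] the numbers k + m', m and d of the sign relation are the
   number of reversed cyclic orders, the number of reversed edges and the
   parity of tau.

   In [rel_ihx] the first graph is I: the inner edge u joins (w, r) and
   (w', r'), and the branches 1, 2, 3, 4 are attached at (w, r+1), (w, r+2),
   (w', r'+1), (w', r'+2).  In H the branches 1, 4, 2, 3 are attached there,
   and in X the branches 1, 3, 4, 2. *)
Inductive gc_relator : GCfree -> Prop :=
| rel_comm G1 G2 :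
    gc_relator (gc_gen G1 * gc_gen G2 -
      ((-1) ^+ (`|dg_deg G1| * `|dg_deg G2|)%N) *: (gc_gen G2 * gc_gen G1))
| rel_sign nv ne nt (D D' : gdata nv ne nt)
    (okD : decorated D) (okD' : decorated D') tau pi eps nu rho :
    compatible D -> compatible D' -> relabelled D D' tau pi eps nu rho ->
    gc_relator (gc_gen (DGraph okD) -
      ((-1) ^+ (#|[set w | odd_perm (rho w)]| + #|[set e | eps e]| + tau)%N)
        *: gc_gen (DGraph okD'))
| rel_as nv ne nt (D : gdata nv ne nt) (w : 'I_nt) (r r' : 'I_3) :
    let D' := reglue D (tperm (inl (w, r)) (inl (w, r'))) in
    forall (okD : decorated D) (okD' : decorated D'),
    r != r' -> gc_relator (gc_gen (DGraph okD) + gc_gen (DGraph okD'))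
| rel_ihx nv ne nt (D : gdata nv ne nt) (w w' : 'I_nt) (r r' : 'I_3) :
    let b : flag ne nt := inl (w, r + 2%:R) in
    let c : flag ne nt := inl (w', r' + 1) in
    let d : flag ne nt := inl (w', r' + 2%:R) in
    let DH := reglue D (tperm b c * tperm b d)%g in
    let DX := reglue D (tperm b d * tperm b c)%g in
    forall (okD : decorated D) (okH : decorated DH) (okX : decorated DX),
    w != w' -> mate D (inl (w, r)) = inl (w', r') ->
    gc_relator
      (gc_gen (DGraph okD) + gc_gen (DGraph okH) + gc_gen (DGraph okX)).

(* The two-sided ideal generated by the relators: the algebra of graphs is
   the quotient of [GCfree] by it. *)
Inductive gc_ideal : GCfree -> Prop :=
| ideal_relator x : gc_relator x -> gc_ideal x
| ideal_0 : gc_ideal 0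
| ideal_add x y : gc_ideal x -> gc_ideal y -> gc_ideal (x + y)
| ideal_mul a b x : gc_ideal x -> gc_ideal (a * x * b).

(* i, j are vertices; their numbers are i.+1, j.+1. *)
Definition sigma n (i j : 'I_n) : rat :=
  if (i < j)%N then (-1) ^+ j.+1 else (-1) ^+ i.+2.

Definition delta_graph G : GCfree :=
  \sum_(e : {e | ~~ self_loop (dg_data G) e})
    sigma (src (dg_data G) (val e)) (tgt (dg_data G) (val e)) *:
      gc_gen (DGraph (decorated_contract (valP e) (dg_ok G))).

(* Contracting the edges of a disjoint union: shifting the vertex numbers of
   the second factor by those of the first multiplies sigma by -1 to the
   number of vertices, i.e. to the degree, of the first factor. *)
Fixpoint delta_word (s : seq (dgraph g)) : GCfree :=
  if s is G :: s' then
    delta_graph G * mkmalgU (FMonom s') 1 +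
    ((-1) ^+ `|dg_deg G|%N) *: (gc_gen G * delta_word s')
  else 0.

Definition delta (x : GCfree) : GCfree :=
  \sum_(m <- msupp x) mcoeff m x *: delta_word (fmonom_val m).

Definition gc_homog (n : nat) (t : int) (x : GCfree) : Prop :=
  forall m, m \in msupp x -> word_ord m = n%:Z /\ word_deg m = t.

Definition gc_loops (n : nat) (t : int) (x : GCfree) : Prop :=
  gc_homog n t x /\ forall m, m \in msupp x -> word_has_loop m.

(* x represents an element of the kernel of delta on the part of order n and
   degree 0. *)
Definition in_H0 (n : nat) (x : GCfree) : Prop :=
  gc_homog n 0 x /\ gc_ideal (delta x).

(* The same in the quotient by the subcomplex spanned by the graphs with at
   least one self-loop. *)
Definition in_H0_sharp (n : nat) (x : GCfree) : Prop :=
  gc_homog n 0 x /\ exists2 y, gc_loops n 1 y & gc_ideal (delta x - y).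

End DGraph.

(* The first component is the partition into edges, the second one the
   partition into vertices. *)
Definition trivalent n
    (p : {set {set 'I_(6 * n)}} * {set {set 'I_(6 * n)}}) : bool :=
  [&& partition p.1 [set: 'I_(6 * n)], partition p.2 [set: 'I_(6 * n)],
      [forall B in p.1, #|B| == 2%N] & [forall B in p.2, #|B| == 3%N]].

Definition topgraph n : finType :=
  {p : {set {set 'I_(6 * n)}} * {set {set 'I_(6 * n)}} | trivalent p}.

Section TopGraph.
Variable n : nat.
Implicit Types (G H : topgraph n) (s : {perm 'I_(6 * n)}).

Definition tg_edges G := (val G).1.
Definition tg_verts G := (val G).2.

Definition tg_carries s G H : bool :=
  ([set [set s x | x in B : {set _}] | B in tg_edges G] == tg_edges H) &&
  ([set [set s x | x in B : {set _}] | B in tg_verts G] == tg_verts H).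

Definition tg_iso G H : bool := [exists s, tg_carries s G H].

Definition tg_aut G := [set s | tg_carries s G G].

Definition tg_connected G : bool :=
  [forall x, forall y, connect (fun a b =>
     [exists B in tg_edges G :|: tg_verts G, (a \in B) && (b \in B)]) x y].

Definition tg_self_loop G : bool :=
  [exists B in tg_edges G, exists A in tg_verts G, B \subset A].

(* X contains exactly one graph of each isomorphism class of graphs in P. *)
Definition iso_representatives (X P : {set topgraph n}) : bool :=
  is_transversal X (equivalence_partition tg_iso P) P.

(* D, which must then be trivalent, has the underlying topological graph G. *)
Definition underlying nv ne nt (D : gdata nv ne nt) G : Prop :=
  exists f : 'I_(6 * n) -> halfedge ne,
    [/\ bijective f,
        forall x y, (pblock (tg_edges G) x == pblock (tg_edges G) y) =
                    ((f x).1 == (f y).1)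
      & forall x y, (pblock (tg_verts G) x == pblock (tg_verts G) y) =
                    (hend D (f x) == hend D (f y))].

End TopGraph.

Definition decorates (R : realType) (g : lieAlgebra R) n
    (G : dgraph g) (T : topgraph n) : Prop :=
  compatible (dg_data G) /\ underlying (dg_data G) T.

(* Psi_n of a topological graph decorated as G. *)
Definition Psi (R : realType) (g : lieAlgebra R) (G : dgraph g) : GCfree g :=
  or_sign (dg_data G) *: gc_gen G.

(* Main.v *)
(* A trivalent graph with all its decorations is a permutation s of the 6n
   half-edges: it tells which half-edge is attached at which position of which
   vertex.  The double cosets of the permutations under renumberings of the
   edges and of the vertices are the topological graphs, and an orbit count
   turns the sum with weights 1/|Aut| into a multiple of the sum over all
   connected s of the graph of s with the sign of s.  In the differential of
   the latter, fix the contracted edge e and permute cyclically three of the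
   four branches next to e: this permutes the set of all s, does not change
   the signs, and the three contracted graphs are those of an IHX relation.
   The three have the same underlying graph, so that the argument also applies
   to the contracted graphs without self-loops only. *)

Require Import Defs.
From mathcomp Require Import all_boot all_order all_algebra all_fingroup.
From mathcomp Require Import reals.
From mathcomp Require Import finmap monalg zify ring.

Set Implicit Arguments.
Unset Strict Implicit.
Unset Printing Implicit Defensive.

Import GRing.Theory.
Local Open Scope ring_scope.

(** * Signs of permutations *)

(** The sign relation is the sign of a permutation in disguise. Renumbering edges moves half-edges
    in pairs, which is even; renumbering vertices moves positions in triples, which has the parity
    of the renumbering; reversing an edge or a cyclic order is an odd permutation of one pair or one
    triple. Hence, modulo the relations, the graph of s multiplied by the sign of s depends only on
    the double coset of s, and for a compatible decoration [or_sign] is the sign of the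
    corresponding s. Two obstacles shape the proof. The sign relation compares compatible cyclic
    orders only, whereas the tripods of s carry arbitrary ones; AS moves are themselves isomorphisms
    of sign -1, and through them the relation extends to all isomorphisms. Moreover, the cyclic move
    at e must be a bijection of all permutations s, while generators exist for connected graphs only
    and self-loops cannot be contracted. Therefore generators and terms of the differential are
    extended by 0 and the move by the identity. Nothing is lost: a disconnected graph has no
    connected contraction. *)

(** Permutations are products of transpositions, so the parity of a multiplicative map is decided by
    its value on them. *)
Lemma odd_perm_hom (A B : finType) (phi : {perm A} -> {perm B}) (c : bool) :
    {morph phi : s t / (s * t)%g} ->
    (forall a b, a != b -> odd_perm (phi (tperm a b)) = c) ->
  forall s, odd_perm (phi s) = c && odd_perm s.
Proof.
move=> phiM phiT s; have [ts -> dts] := prod_tpermP s.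
have phi1 : phi 1%g = 1%g by apply: (mulgI (phi 1%g)); rewrite -phiM !mulg1.
elim: ts dts => [_|t ts IH] /=; first by rewrite big_nil phi1 !odd_perm1 andbF.
case/andP=> dt dts; rewrite !big_cons phiM !odd_permM IH // phiT //.
by rewrite odd_tperm dt; case: c {phiT IH}.
Qed.

Section Conjugation.
Variables (A B : finType) (f : A -> B) (f' : B -> A).
Hypotheses (fK : cancel f f') (f'K : cancel f' f).

Lemma conj_perm_inj (s : {perm A}) : injective (fun x => f (s (f' x))).
Proof. by move=> x y /(can_inj fK)/perm_inj/(can_inj f'K). Qed.

Definition conj_perm s : {perm B} := perm (@conj_perm_inj s).

Lemma conj_permE s x : conj_perm s x = f (s (f' x)).
Proof. by rewrite permE. Qed.

Lemma odd_conj_perm s : odd_perm (conj_perm s) = odd_perm s.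
Proof.
rewrite (@odd_perm_hom _ _ conj_perm true) // => [u v|a b ab].
  by apply/permP => x; rewrite permM !conj_permE permM fK.
suff -> : conj_perm (tperm a b) = tperm (f a) (f b).
  by rewrite odd_tperm (can_eq fK).
apply/permP => x; rewrite conj_permE -{2}[x]f'K.
by rewrite (inj_tperm _ _ _ (can_inj fK)).
Qed.

End Conjugation.

Section Wreath.
Variables (A B : finType).
Implicit Types (tau : {perm A}) (rho : A -> {perm B}).

Lemma wreath_inj tau rho : injective (fun x : A * B => (tau x.1, rho x.1 x.2)).
Proof. by move=> [a b] [a' b'] /= [/perm_inj -> /perm_inj ->]. Qed.

Definition wreath tau rho : {perm A * B} := perm (@wreath_inj tau rho).

Lemma wreathE tau rho x : wreath tau rho x = (tau x.1, rho x.1 x.2).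
Proof. by rewrite permE. Qed.

Lemma odd_wreath_fibre a (s : {perm B}) :
  odd_perm (wreath 1 (fun a' => if a' == a then s else 1%g)) = odd_perm s.
Proof.
pose phi (s : {perm B}) := wreath 1 (fun a' => if a' == a then s else 1%g).
rewrite -/(phi s) (@odd_perm_hom _ _ phi true) // => [u v|b b' bb'].
  apply/permP => -[a' b]; rewrite permM !wreathE /= !perm1.
  by case: eqP => _; rewrite ?permM ?perm1.
suff -> : phi (tperm b b') = tperm (a, b) (a, b').
  by rewrite odd_tperm xpair_eqE eqxx.
apply/permP => -[a' x]; rewrite wreathE /= perm1.
have [->|aa'] := eqVneq a' a.
  by rewrite -(inj_tperm _ _ _ (can_inj (fun x => erefl ((a, x).2)))).
by rewrite perm1 tpermD // xpair_eqE eq_sym (negPf aa').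
Qed.

Lemma odd_wreath_fibres rho :
  odd_perm (wreath 1 rho) = odd (\sum_a odd_perm (rho a)).
Proof.
suff main (r : seq A) : uniq r ->
    odd_perm (wreath 1 (fun a => if a \in r then rho a else 1%g)) =
    odd (\sum_(a <- r) odd_perm (rho a)).
  rewrite -main ?index_enum_uniq //; congr odd_perm; apply/permP => -[a b].
  by rewrite !wreathE /= mem_index_enum.
elim: r => [_|a r IH /= /andP[ar ur]].
  rewrite big_nil -[RHS](odd_perm1 (A * B)%type); congr odd_perm.
  by apply/permP => -[a b]; rewrite wreathE /= !perm1.
rewrite big_cons oddD -IH // oddb -(odd_wreath_fibre a) -odd_permM.
congr odd_perm; apply/permP => -[a' b]; rewrite permM !wreathE /= !perm1 inE.
by have [->|] := eqVneq a' a; rewrite ?(negPf ar) ?perm1.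
Qed.

(** A transposition of [A] acts on [A * B] by one transposition in each slice [A * {b}], hence by
    [#|B|] disjoint transpositions. *)
Lemma odd_wreath_base tau :
  odd_perm (wreath tau (fun=> 1%g)) = odd #|B| && odd_perm tau.
Proof.
rewrite (@odd_perm_hom _ _ (fun tau => wreath tau (fun=> 1%g)) (odd #|B|)) //.
  by move=> u v; apply/permP => -[a b]; rewrite permM !wreathE /= !permM !perm1.
move=> a a' aa'.
suff main (r : seq B) : uniq r -> exists2 p : {perm A * B},
    odd_perm p = odd (size r) &
    p =1 (fun x => if x.2 \in r then (tperm a a' x.1, x.2) else x).
  have [p po pE] := main _ (enum_uniq B); rewrite cardE -po; congr odd_perm.
  apply/permP => -[x b]; rewrite pE wreathE /= perm1.
  by rewrite (mem_enum B b).
elim: r => [_|b r IH /= /andP[br /IH[p po pE]]].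
  by exists 1%g => [|x]; rewrite ?odd_perm1 ?perm1.
exists (p * tperm (a, b) (a', b))%g => [|[x y]].
  by rewrite odd_permM po odd_tperm xpair_eqE (negPf aa') addbT.
rewrite permM pE /= inE; have [->|yb] := eqVneq y b.
  by rewrite (negPf br) -(inj_tperm _ _ _ (can_inj (fun x =>
    erefl ((x, b).1)))).
have neq (c d : A) : (c, b) != (d, y).
  by rewrite xpair_eqE [b == y]eq_sym (negPf yb) andbF.
by case: (y \in r); rewrite (tpermD (neq _ _) (neq _ _)).
Qed.

(** For [B = bool] the base contributes nothing, for [B = 'I_3] it contributes the parity of [tau]:
    edge renumberings cost no sign, vertex renumberings do. *)
Lemma odd_wreath tau rho :
  odd_perm (wreath tau rho) =
  (odd #|B| && odd_perm tau) (+) odd (\sum_a odd_perm (rho a)).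
Proof.
rewrite -odd_wreath_base -odd_wreath_fibres addbC -odd_permM; congr odd_perm.
by apply/permP => -[a b]; rewrite permM !wreathE /= !perm1.
Qed.

Lemma wreathP (b0 : B) (u : {perm A * B}) :
    (forall x y, ((u x).1 == (u y).1) = (x.1 == y.1)) ->
  exists tau rho, u = wreath tau rho.
Proof.
move=> u1; have u1E a b : (u (a, b)).1 = (u (a, b0)).1.
  by apply/eqP; rewrite u1.
have tau_inj : injective (fun a => (u (a, b0)).1).
  by move=> a a' /eqP; rewrite u1 => /eqP.
have rho_inj a : injective (fun b => (u (a, b)).2).
  move=> b b' e; have /perm_inj[] // : u (a, b) = u (a, b').
  by apply/eqP; rewrite -pair_eqE /pair_eq /= u1 e !eqxx.
exists (perm tau_inj), (fun a => perm (rho_inj a)).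
by apply/permP => -[a b];
  rewrite wreathE !permE /= -(u1E a b) -surjective_pairing.
Qed.

End Wreath.

(** * Isomorphisms of decorated graphs *)

Lemma connect_homo (A B : finType) (r : rel A) (r' : rel B) (f : A -> B) :
  {homo f : x y / r x y >-> r' x y} ->
  {homo f : x y / connect r x y >-> connect r' x y}.
Proof.
move=> fr x y /connectP[p rp ->] {y}; elim: p x rp => [|z p IH] x //=.
by case/andP=> /fr xz /IH; apply: connect_trans (connect1 xz).
Qed.

Section Relabelling.
Variables nv ne nt : nat.
Implicit Types (D : gdata nv ne nt) (tau : 'S_nv) (pi : 'S_ne).
Implicit Types (eps : {ffun 'I_ne -> bool}) (nu : 'S_nt).
Implicit Types (rho : {ffun 'I_nt -> 'S_3}).

Definition relabel_half pi eps (h : halfedge ne) : halfedge ne :=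
  (pi h.1, h.2 (+) eps h.1).

(** The local map [phi] of [relabelled], named so that it can be composed and inverted. *)
Definition relabel_flag pi eps nu rho (x : flag ne nt) : flag ne nt :=
  match x with
  | inl y => inl (nu y.1, rho y.1 y.2)
  | inr h => inr (relabel_half pi eps h)
  end.

(** The sign of the sign relation as a product over edges and tree vertices, a form in which it is
    visibly multiplicative under composition. *)
Definition relabel_sign tau eps rho : rat :=
  (-1) ^+ tau * \prod_e (-1) ^+ eps e * \prod_w (-1) ^+ rho w.

Lemma relabel_signE tau eps rho :
  relabel_sign tau eps rho =
  (-1) ^+ (#|[set w | odd_perm (rho w)]| + #|[set e | eps e]| + tau)%N.
Proof.
have prodE (I : finType) (b : I -> bool) :
    \prod_i (-1) ^+ b i = (-1) ^+ #|[set i | b i]| :> rat.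
  rewrite -sum1dep_card [in RHS]big_mkcond /= expr_sum; apply: eq_bigr => i _.
  by case: (b i).
by rewrite /relabel_sign !prodE !exprD mulrC mulrA [RHS]mulrAC mulrAC.
Qed.

Lemma relabel_half_inj pi eps : injective (relabel_half pi eps).
Proof.
by move=> [e b] [e' b'] [/perm_inj <-]; rewrite /= => /addIb ->.
Qed.

Lemma relabel_flag_inj pi eps nu rho : injective (relabel_flag pi eps nu rho).
Proof.
move=> [[w r]|h] [[w' r']|h'] //= [].
  by move=> /perm_inj <- /perm_inj <-.
move=> e1 e2; congr inr; apply: (@relabel_half_inj pi eps).
by rewrite /relabel_half e1 e2.
Qed.

Lemma relabel_flagP pi eps nu rho y :
  exists x, y = relabel_flag pi eps nu rho x.
Proof.
have [g _ gK] := injF_bij (@relabel_flag_inj pi eps nu rho).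
by exists (g y); rewrite gK.
Qed.

(** The relabelling itself is hidden and only its sign is kept, since the relations see nothing
    else. Cyclic orders are arbitrary here. *)
Definition isomorphic D D' (c : rat) := exists tau pi eps nu rho,
  relabelled D D' tau pi eps nu rho /\ c = relabel_sign tau eps rho.

Lemma isomorphic_sqr D D' c : isomorphic D D' c -> c * c = 1.
Proof.
by move=> [tau [_ [eps [_ [rho [_ ->]]]]]];
  rewrite relabel_signE -expr2 sqrr_sign.
Qed.

Lemma isomorphic_refl D : isomorphic D D 1.
Proof.
exists 1%g, 1%g, [ffun=> false], 1%g, [ffun=> 1%g]; split.
  have relE x : relabel_flag 1 [ffun=> false] 1 [ffun=> 1%g] x = x.
    by case: x => -[y z]; rewrite /= /relabel_half /= ?ffunE !perm1 ?addbF.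
  by move=> x; rewrite -!/(relabel_flag _ _ _ _ _) !relE perm1.
rewrite /relabel_sign odd_perm1 !big1 ?mulr1 // => i _; rewrite ffunE //.
by rewrite odd_perm1.
Qed.

Lemma isomorphic_trans D1 D2 D3 c c' :
  isomorphic D1 D2 c -> isomorphic D2 D3 c' -> isomorphic D1 D3 (c * c').
Proof.
move=> [tau [pi [eps [nu [rho [H ->]]]]]] [tau' [pi' [eps' [nu' [rho' [H'
  ->]]]]]].
exists (tau * tau')%g, (pi * pi')%g, [ffun e => eps e (+) eps' (pi e)].
exists (nu * nu')%g, [ffun w => (rho w * rho' (nu w))%g]; split.
  have relE x : relabel_flag (pi * pi') [ffun e => eps e (+) eps' (pi e)]
      (nu * nu') [ffun w => (rho w * rho' (nu w))%g] x =
      relabel_flag pi' eps' nu' rho' (relabel_flag pi eps nu rho x).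
    case: x => -[y z] /=; first by rewrite ffunE !permM.
    by rewrite /relabel_half /= ffunE permM addbA.
  move=> x; rewrite -!/(relabel_flag _ _ _ _ _) !relE permM.
  have [<- mE] := H x; have [<- mE'] := H' (relabel_flag pi eps nu rho x).
  by split=> //; rewrite [LHS]mE' mE.
have prodE (I : finType) (b1 b2 : I -> bool) :
    \prod_i (-1) ^+ (b1 i (+) b2 i) =
    (\prod_i (-1) ^+ b1 i) * \prod_i (-1) ^+ b2 i :> rat.
  by rewrite -big_split; apply: eq_bigr => i _; rewrite signr_addb.
rewrite /relabel_sign odd_permM signr_addb.
have -> : \prod_e (-1) ^+ [ffun e => eps e (+) eps' (pi e)] e =
    (\prod_e (-1) ^+ eps e) * \prod_e (-1) ^+ eps' e :> rat.
  rewrite [X in _ * X](reindex_inj (@perm_inj _ pi)) -prodE.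
  by apply: eq_bigr => e _; rewrite ffunE.
have -> : \prod_w (-1) ^+ [ffun w => (rho w * rho' (nu w))%g] w =
    (\prod_w (-1) ^+ rho w) * \prod_w (-1) ^+ rho' w :> rat.
  rewrite [X in _ * X](reindex_inj (@perm_inj _ nu)) -prodE.
  by apply: eq_bigr => w _; rewrite ffunE odd_permM.
by rewrite mulrACA [X in X * _]mulrACA.
Qed.

Lemma isomorphic_sym D D' c : isomorphic D D' c -> isomorphic D' D c.
Proof.
move=> [tau [pi [eps [nu [rho [H ->]]]]]].
exists (tau^-1)%g, (pi^-1)%g, [ffun e => eps ((pi^-1)%g e)], (nu^-1)%g.
exists [ffun w => ((rho ((nu^-1)%g w))^-1)%g]; split.
  have relE x : relabel_flag (pi^-1) [ffun e => eps ((pi^-1)%g e)] (nu^-1)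
      [ffun w => ((rho ((nu^-1)%g w))^-1)%g] (relabel_flag pi eps nu rho x) = x.
    case: x => -[y z] /=; first by rewrite ffunE !permK.
    by rewrite /relabel_half /= ffunE permK addbK.
  move=> x; rewrite -!/(relabel_flag _ _ _ _ _).
  have [z ->] := relabel_flagP pi eps nu rho x; have [/= fE mE] := H z.
  by rewrite fE mE !relE permK.
rewrite /relabel_sign odd_permV; congr (_ * _ * _).
  rewrite (reindex_inj (@perm_inj _ pi^-1)); apply: eq_bigr => e _.
  by rewrite ffunE.
rewrite (reindex_inj (@perm_inj _ nu^-1)); apply: eq_bigr => w _.
by rewrite ffunE odd_permV.
Qed.

Section Relabelled.
Variables (D D' : gdata nv ne nt) (tau : 'S_nv) (pi : 'S_ne).
Variables (eps : {ffun 'I_ne -> bool}) (nu : 'S_nt).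
Variables (rho : {ffun 'I_nt -> 'S_3}).
Hypothesis H : relabelled D D' tau pi eps nu rho.

Let phi := relabel_flag pi eps nu rho.

Lemma relabelled_at x : flag_at D' (phi x) = tau (flag_at D x).
Proof. by case: (H x). Qed.

Lemma relabelled_mate x : mate D' (phi x) = phi (mate D x).
Proof. by case: (H x). Qed.

Lemma relabelled_hend h : hend D' (relabel_half pi eps h) = tau (hend D h).
Proof. exact: (relabelled_at (inr h)). Qed.

Lemma relabelled_own w : own D' (nu w) = tau (own D w).
Proof. exact: (relabelled_at (inl (w, ord0))). Qed.

Lemma relabelled_ends e :
  (src D' (pi e), tgt D' (pi e)) =
  if eps e then (tau (tgt D e), tau (src D e))
  else (tau (src D e), tau (tgt D e)).
Proof.
have := relabelled_hend (e, false); have := relabelled_hend (e, true).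
by rewrite /hend /=; case: (eps e) => /= -> ->.
Qed.

Lemma relabelled_self_loop e : self_loop D' (pi e) = self_loop D e.
Proof.
have [] := relabelled_ends e; rewrite /self_loop.
by case: (eps e) => -[-> ->]; rewrite (inj_eq perm_inj) // eq_sym.
Qed.

Lemma relabelled_decorated : decorated D -> decorated D'.
Proof.
have phiP := relabel_flagP pi eps nu rho.
case/and5P => nv0 /forallP conn /forallP val mateP.
case/and3P => /forallP atP /forallP tree /forallP cnt.
have valE v : valency D' (tau v) = valency D v.
  rewrite /valency -[RHS](card_imset _ (@relabel_half_inj pi eps)).
  apply: eq_card => h; have [g _ gK] := injF_bij (@relabel_half_inj pi eps).
  rewrite -(gK h) (mem_imset _ _ (@relabel_half_inj pi eps)) !inE.
  by rewrite relabelled_hend (inj_eq perm_inj).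
apply/and5P; split=> //.
- apply/forallP => v; apply/forallP => v';
  rewrite -(permKV tau v) -(permKV tau v').
  have /forallP/(_ ((tau^-1)%g v')) := conn ((tau^-1)%g v).
  apply: connect_homo => u u' /existsP[e uu']; apply/existsP; exists (pi e).
  have [] := relabelled_ends e.
  by case: (eps e) => -[-> ->];
    rewrite !(inj_eq perm_inj) // orbC [X in X || _]andbC [X in _ || X]andbC.
- by apply/forallP => v; rewrite -(permKV tau v) valE.
- apply/forallP => y; have [x ->] := phiP y; rewrite !relabelled_mate.
  by rewrite !(inj_eq (@relabel_flag_inj _ _ _ _)); exact: (forallP mateP).
- apply/and3P; split.
  + apply/forallP => y; have [x ->] := phiP y.
    by rewrite relabelled_mate !relabelled_at (eqP (atP x)).
  + apply/forallP => y; apply/forallP => y'; apply/implyP.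
    have [x ->] := phiP y; have [x' ->] := phiP y'.
    rewrite !relabelled_at (inj_eq perm_inj) => xx'.
    have /forallP/(_ x')/implyP/(_ xx') := tree x.
    apply: connect_homo => z z'; rewrite /tree_adj relabelled_mate.
    rewrite (inj_eq (@relabel_flag_inj _ _ _ _)) => /orP[->//|].
    by case: z z' => [z|//] [z'|//] /= /eqP ->; rewrite eqxx orbT.
  + apply/forallP => v; rewrite -(permKV tau v) valE (eqP (cnt _)).
    apply/eqP; congr (_ + _)%N; rewrite -[LHS](card_imset _ (@perm_inj _ nu)).
    apply: eq_card => w; rewrite -(permKV nu w) (mem_imset _ _ (@perm_inj _
      nu)).
    by rewrite !inE relabelled_own (inj_eq perm_inj).
Qed.

End Relabelled.

Lemma isomorphic_decorated D D' c : isomorphic D D' c ->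
  decorated D = decorated D'.
Proof.
move=> DD'; have [tau [pi [eps [nu [rho [H _]]]]]] := DD'.
have [tau' [pi' [eps' [nu' [rho' [H' _]]]]]] := isomorphic_sym DD'.
by apply/idP/idP => /(relabelled_decorated _); apply; [exact: H | exact: H'].
Qed.

End Relabelling.

(** * Congruence modulo the relations *)

Section Ideal.
Variables (R : realType) (g : lieAlgebra R).
Implicit Types (x y z : GCfree g).

(* After [scalerA] the product lives in the scalar ring inferred for [GCfree],
   which rewriting does not identify with [rat]. *)
Lemma gc_scalerA (a b : rat) x : a *: (b *: x) = (a * b) *: x.
Proof. exact: scalerA. Qed.

Lemma gc_scaler0 (a : rat) : a *: (0 : GCfree g) = 0.
Proof. exact: scaler0. Qed.

Lemma gc_idealZ c x : gc_ideal x -> gc_ideal (c *: x).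
Proof.
by move=> /(ideal_mul c%:MP 1); rewrite mulr1 mul_malgC.
Qed.

Lemma gc_idealN x : gc_ideal x -> gc_ideal (- x).
Proof. by rewrite -scaleN1r; apply: gc_idealZ. Qed.

Lemma gc_ideal_sum (I : Type) (r : seq I) (P : pred I) (F : I -> GCfree g) :
  (forall i, P i -> gc_ideal (F i)) -> gc_ideal (\sum_(i <- r | P i) F i).
Proof.
move=> PF; elim/big_rec: _ => [|i x /PF]; first exact: ideal_0.
exact: ideal_add.
Qed.

Definition gc_eq x y := gc_ideal (x - y).

Lemma gc_eq_refl x : gc_eq x x.
Proof. by rewrite /gc_eq subrr; apply: ideal_0. Qed.

Lemma gc_eq_sym x y : gc_eq x y -> gc_eq y x.
Proof. by move/gc_idealN; rewrite opprB. Qed.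

Lemma gc_eq_trans y x z : gc_eq x y -> gc_eq y z -> gc_eq x z.
Proof. by move=> xy yz; have := ideal_add xy yz; rewrite addrA subrK. Qed.

Lemma gc_eqZ c x y : gc_eq x y -> gc_eq (c *: x) (c *: y).
Proof. by rewrite /gc_eq -scalerBr; apply: gc_idealZ. Qed.

Lemma gc_eqN x y : gc_eq x y -> gc_eq (- x) (- y).
Proof. by rewrite /gc_eq -opprD; apply: gc_idealN. Qed.

Lemma gc_eq_sum (I : Type) (r : seq I) (P : pred I) (F G : I -> GCfree g) :
  (forall i, P i -> gc_eq (F i) (G i)) ->
  gc_eq (\sum_(i <- r | P i) F i) (\sum_(i <- r | P i) G i).
Proof. by move=> FG; rewrite /gc_eq -sumrB; apply: gc_ideal_sum. Qed.

Lemma gc_eq_ideal x y : gc_eq x y -> gc_ideal y -> gc_ideal x.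
Proof. by move=> xy /(ideal_add xy); rewrite subrK. Qed.

(** The extension by 0 lets sums run over all permutations, including those whose graph is
    disconnected. *)
Definition gen nv ne nt (D : gdata nv ne nt) : GCfree g :=
  if @idP (decorated D) is ReflectT okD then gc_gen (DGraph g okD) else 0.

Lemma gen_decorated nv ne nt (D : gdata nv ne nt) (okD : decorated D) :
  gen D = gc_gen (DGraph g okD).
Proof.
rewrite /gen; case: {-}_ / idP => [ok|/(_ okD)[]].
by rewrite (bool_irrelevance ok okD).
Qed.

Lemma gen_not_decorated nv ne nt (D : gdata nv ne nt) : ~~ decorated D ->
  gen D = 0.
Proof. by rewrite /gen; case: {-}_ / idP => // ok /negP[]. Qed.

End Ideal.

(** * Compatible cyclic orders and the AS relation *)

Lemma hrank_inj ne : injective (@hrank ne).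
Proof.
move=> [e b] [e' b']; rewrite /hrank /= => /[dup] /(congr1 odd).
rewrite !oddD !odd_double !oddb !addFb => -> /addIn/double_inj/val_inj -> //.
Qed.

Lemma ord3P (r : 'I_3) : [\/ r = 0, r = 1 | r = 2%:R].
Proof.
case: r => -[|[|[|//]]] lt_r; [constructor 1 | constructor 2 | constructor 3];
  exact: val_inj.
Qed.

Lemma ord3_arith :
  (((1 + 1 = 2%:R :> 'I_3)%R * (0 + 1 = 1 :> 'I_3)%R *
    (2%:R + 1 = 0 :> 'I_3)%R) *
   ((0 + 2%:R = 2%:R :> 'I_3)%R * (1 + 2%:R = 0 :> 'I_3)%R *
    (2%:R + 2%:R = 1 :> 'I_3)%R))%type.
Proof. by do !split; apply: val_inj. Qed.

Section Compatible.
Variables nv ne nt : nat.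
Implicit Types (D : gdata nv ne nt) (l : 'I_3 -> option (halfedge ne)).

Definition leaf_at D w (r : 'I_3) : option (halfedge ne) :=
  if mate D (inl (w, r)) is inr a then Some a else None.

(** A decidable condition at a single tree vertex that implies [compatible], so that the wrong
    vertices can be counted. The alternatives are the rotations of one cyclic order. *)
Definition cyclically_ordered l : bool :=
  match l 0, l 1, l 2%:R with
  | Some a, Some b, Some c =>
      [|| (hrank a < hrank b < hrank c)%N, (hrank b < hrank c < hrank a)%N
        | (hrank c < hrank a < hrank b)%N]
  | Some a, Some b, None | None, Some a, Some b | Some b, None, Some a =>
      (hrank a < hrank b)%N
  | _, _, _ => true
  end.

Lemma cyclically_ordered_compatible D :
  (forall w, cyclically_ordered (leaf_at D w)) -> compatible D.
Proof.
move=> ordD; split=> [w r a b c | w a] ma => [mb mc|]; have := ordD w;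
  rewrite /cyclically_ordered /leaf_at.
  by move: ma mb mc; case: (ord3P r) => ->; rewrite !ord3_arith => -> -> ->.
rewrite !ma => /or3P[] /andP[lt1 lt2]; [exists 0 | exists 1 | exists 2%:R];
  by rewrite !ord3_arith.
Qed.

(** Three edges have only two cyclic orders, so exchanging two of them repairs a wrong one.
    Injectivity of [l] on leaves makes their ranks distinct. *)
Lemma cyclically_ordered_flip l :
    (forall r r' a, l r = Some a -> l r' = Some a -> r = r') ->
    ~~ cyclically_ordered l ->
  exists r r', r != r' /\ cyclically_ordered (fun s => l (tperm r r' s)).
Proof.
have neq a b r r' : (forall r r' a, l r = Some a -> l r' = Some a -> r = r') ->
    r != r' -> l r = Some a -> l r' = Some b ->
    (hrank a < hrank b)%N = ~~ (hrank b < hrank a)%N.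
  move=> linj rr' la lb; rewrite -leqNgt ltn_neqAle;
    case: eqP => // /hrank_inj ab.
  by case/eqP: rr'; apply: linj la _; rewrite lb ab.
move=> /[dup] linj /neq{}neq.
case E0: (l 0) => [a|]; case E1: (l 1) => [b|]; case E2: (l 2%:R) => [c|];
  rewrite /cyclically_ordered E0 E1 ?E2 //=.
- have ab := neq a b 0 1 isT E0 E1; have bc := neq b c 1 2%:R isT E1 E2.
  have ca := neq c a 2%:R 0 isT E2 E0.
  move=> H; exists 0, 1; split=> //; rewrite tpermL tpermR tpermD //.
  by rewrite E0 E1 E2; lia.
- have ab := neq a b 0 1 isT E0 E1.
  move=> H; exists 0, 1; split=> //; rewrite tpermL tpermR tpermD //.
  by rewrite E0 E1 E2; lia.
- have ab := neq a c 0 2%:R isT E0 E2.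
  move=> H; exists 0, 2%:R; split=> //; rewrite tpermL tpermR tpermD //.
  by rewrite E0 E1 E2; lia.
- have ab := neq b c 1 2%:R isT E1 E2.
  move=> H; exists 1, 2%:R; split=> //; rewrite tpermL tpermR tpermD //.
  by rewrite E0 E1 E2; lia.
Qed.

Definition flip D w r r' := reglue D (tperm (inl (w, r)) (inl (w, r'))).

Lemma flip_relabelled D w r r' :
  relabelled D (flip D w r r') 1 1 [ffun=> false] 1
    [ffun w' => if w' == w then tperm r r' else 1%g].
Proof.
have relE (x : flag ne nt) : relabel_flag 1 [ffun=> false] 1
    [ffun w' => if w' == w then tperm r r' else 1%g] x =
    tperm (inl (w, r)) (inl (w, r')) x.
  case: x => [[w' s]|[e b]] /=; last first.
    by rewrite /relabel_half /= ffunE perm1 addbF tpermD.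
  rewrite ffunE perm1; have [->|ww'] := eqVneq w' w.
    have inj_inl : injective (fun r1 =>
      inl (w, r1) : flag ne nt) by move=> ? ? [].
    exact: (inj_tperm _ _ _ inj_inl).
  have neq s1 : inl (w, s1) != inl (w', s) :> flag ne nt.
    by rewrite (inj_eq (@inl_inj _ _)) xpair_eqE eq_sym (negPf ww').
  by rewrite perm1 tpermD.
move=> x; rewrite -!/(relabel_flag _ _ _ _ _) !relE perm1 ffunE permK.
by split=> //; case: tpermP => [->|->|_ _].
Qed.

(** An AS move is an isomorphism that renumbers nothing and reverses one cyclic order, so its sign
    agrees with that of the AS relation. *)
Lemma flip_isomorphic D w r r' : r != r' -> isomorphic D (flip D w r r') (-1).
Proof.
move=> rr'; exists 1%g, 1%g, [ffun=> false], 1%g.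
exists [ffun w' => if w' == w then tperm r r' else 1%g]; split.
  exact: flip_relabelled.
rewrite /relabel_sign odd_perm1 mul1r big1 => [|e _]; last by rewrite ffunE.
rewrite mul1r (bigD1 w) //= ffunE eqxx odd_tperm rr' big1 ?mulr1 // => w' ww'.
by rewrite ffunE (negPf ww') odd_perm1.
Qed.

Lemma leaf_at_flip D w r r' w' s :
  leaf_at (flip D w r r') w' s =
  leaf_at D w' (if w' == w then tperm r r' s else s).
Proof.
have := relabelled_mate (flip_relabelled D w r r')
  (inl (w', if w' == w then tperm r r' s else s)).
have -> : relabel_flag 1 [ffun=> false] 1
    [ffun w' => if w' == w then tperm r r' else 1%g]
    (inl (w', if w' == w then tperm r r' s else s)) = inl (w', s) :> flag ne nt.
  by rewrite /= ffunE perm1; case: eqP => _; rewrite ?tpermK ?perm1.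
rewrite /leaf_at => ->; case: (mate D _) => //= -[e b].
by rewrite /relabel_half /= ffunE perm1 addbF.
Qed.

End Compatible.

Section SignRelation.
Variables (R : realType) (g : lieAlgebra R) (nv ne nt : nat).
Implicit Types (D : gdata nv ne nt).

Lemma gen_flip D w r r' : r != r' ->
  gc_eq (gen g D) (- gen g (flip D w r r')).
Proof.
move=> rr'; have := isomorphic_decorated (flip_isomorphic D w rr').
have [okD okD'|noD noD'] := boolP (decorated D); last first.
  by rewrite !gen_not_decorated -?noD' // oppr0; apply: gc_eq_refl.
rewrite (gen_decorated g okD) (gen_decorated g (esym okD')) /gc_eq opprK.
exact/ideal_relator/rel_as.
Qed.

(** Induction on the number of wrongly ordered tree vertices: an AS move repairs one of them and
    leaves the others alone. The same sign [c] serves the isomorphism and the congruence. *)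
Lemma compatible_flips D : decorated D -> exists D' c,
  [/\ isomorphic D D' c, compatible D' & gc_eq (gen g D) (c *: gen g D')].
Proof.
have [m] := ubnP #|[set w | ~~ cyclically_ordered (leaf_at D w)]|.
elim: m D => // m IH D ltm okD.
have [/forallP ordD|] := boolP [forall w, cyclically_ordered (leaf_at D w)].
  exists D, 1; split; [exact: isomorphic_refl | | ].
    exact: cyclically_ordered_compatible.
  by rewrite scale1r; apply: gc_eq_refl.
rewrite negb_forall => /existsP[w badw].
have [|r [r' [rr' ordw]]] := cyclically_ordered_flip _ badw.
  move=> r r' a; rewrite /leaf_at.
  case E: (mate D _) => [//|b] [ba]; case E': (mate D _) => [//|b'] [b'a].
  have /(can_inj (mateK okD))[] // :
      mate D (inl (w, r)) = mate D (inl (w, r')) by rewrite E E' ba b'a.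
have iso1 := flip_isomorphic D w rr'.
have [||D' [c [isoD' compD' genD']]] := IH (flip D w r r').
- rewrite -ltnS; apply: leq_trans ltm; rewrite ltnS; apply: proper_card.
  apply/properP; split; last first.
    exists w; rewrite !inE // negbK /cyclically_ordered !leaf_at_flip eqxx.
    exact: ordw.
  apply/subsetP => w'; rewrite !inE; have [->//|ww'] := eqVneq w' w.
  by rewrite /cyclically_ordered !leaf_at_flip (negPf ww').
- by rewrite -(isomorphic_decorated iso1).
exists D', (-1 * c); split; [exact: isomorphic_trans isoD' | exact: compD' | ].
apply: gc_eq_trans (gen_flip D w rr') _.
by rewrite mulN1r scaleNr; apply: gc_eqN.
Qed.

(** AS moves make both sides compatible. The sign relation applies to the composite isomorphism
    between the repaired graphs, and the signs of the moves cancel because each isomorphism sign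
    squares to 1. *)
Lemma isomorphic_gen D D' c :
  isomorphic D D' c -> gc_eq (gen g D) (c *: gen g D').
Proof.
move=> iso; have okE := isomorphic_decorated iso.
have [okD|noD] := boolP (decorated D); last first.
  by rewrite !gen_not_decorated -?okE // scaler0; apply: gc_eq_refl.
have okD' : decorated D' by rewrite -okE.
have [D1 [c1 [iso1 comp1 gen1]]] := compatible_flips okD.
have [D2 [c2 [iso2 comp2 gen2]]] := compatible_flips okD'.
have iso12 := isomorphic_trans (isomorphic_sym iso1) (isomorphic_trans iso
  iso2).
have c1c1 := isomorphic_sqr iso1.
have okD1 : decorated D1 by rewrite -(isomorphic_decorated iso1).
have okD2 : decorated D2 by rewrite -(isomorphic_decorated iso2).
have gen12 : gc_eq (gen g D1) ((c1 * (c * c2)) *: gen g D2).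
  have [tau [pi [eps [nu [rho [H ->]]]]]] := iso12.
  rewrite (gen_decorated g okD1) (gen_decorated g okD2) relabel_signE.
  apply: ideal_relator; exact: (rel_sign g okD1 okD2 comp1 comp2 H).
apply: gc_eq_trans gen1 _; apply: gc_eq_trans (gc_eqZ _ gen12) _.
rewrite gc_scalerA mulrA c1c1 mul1r -gc_scalerA; apply: gc_eqZ.
exact: gc_eq_sym.
Qed.

End SignRelation.

(** * Contraction of an edge of isomorphic graphs *)

(** [s] is [lift_perm i (s i) t], where taking [i] to [s i] past the remaining points costs the
    parity of [i + s i]. *)
Lemma lift_permP n (s : 'S_n) (i : 'I_n) :
  exists2 t : 'S_n.-1, forall k, s (lift i k) = lift (s i) (t k) &
    odd_perm t = odd_perm s (+) (odd i (+) odd (s i)).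
Proof.
case: n s i => [s []//|n] s i.
have sE k : {k' | s (lift i k) = lift (s i) k'}.
  case: (unliftP (s i) (s (lift i k))) => [k' ->|/perm_inj/eqP];
    first by exists k'.
  by rewrite eq_sym (negPf (neq_lift _ _)).
have t_inj : injective (fun k => sval (sE k)).
  move=> k k' /(congr1 (lift (s i))); rewrite -(svalP (sE k)) -(svalP (sE k')).
  by move/perm_inj/lift_inj.
exists (perm t_inj) => [k|]; first by rewrite permE -(svalP (sE k)).
suff sP : lift_perm i (s i) (perm t_inj) = s.
  have := congr1 (@odd_perm _) sP; rewrite odd_lift_perm => <-.
  by rewrite addbC addbA addbb.
apply/permP => k; case: (unliftP i k) => [k' ->|->];
  last by rewrite lift_perm_id.
by rewrite lift_perm_lift permE -(svalP (sE k')).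
Qed.

Lemma eq_sign m n : odd m = odd n -> (-1) ^+ m = (-1) ^+ n :> rat.
Proof. by move=> mn; rewrite -signr_odd mn signr_odd. Qed.

Section MergePerm.
Variable n : nat.
Implicit Types (i j k : 'I_n).

(** The end whose number disappears in the merger; away from it, [merge] is the inverse of
    [lift]. *)
Definition max_ord i j := if (i < j)%N then j else i.

Lemma merge_lift i j (ij : i != j) (k : 'I_n.-1) : Defs.merge ij (lift (max_ord
  i j) k) = k.
Proof.
apply: val_inj; rewrite /= /merge_nat /bump /max_ord; move: ij;
  rewrite -val_eqE /=.
case: (ltngtP i j) => //= lt_ij _.
- by do 2?case: ifP; lia.
- by do 2?case: ifP; lia.
Qed.

Lemma merge_ends i j (ij : i != j) : Defs.merge ij i = Defs.merge ij j.
Proof.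
apply: val_inj; rewrite /= /merge_nat; move: ij; rewrite -val_eqE /=.
by case: (ltngtP i j) => //= lt_ij _; rewrite eqxx; do ?case: ifP; lia.
Qed.

Lemma merge_inj i j (ij : i != j) k k' : Defs.merge ij k = Defs.merge ij k' ->
  [|| k == k', (k == i) && (k' == j) | (k == j) && (k' == i)].
Proof.
move/(congr1 val); rewrite /= /merge_nat; move: ij; rewrite -!val_eqE /=.
move: (val k) (val k') (val i) (val j) => {}k {}k' a b.
case: (eqVneq k (maxn a b)); case: (eqVneq k' (maxn a b));
  by case: (ltnP (maxn a b) k); case: (ltnP (maxn a b) k'); lia.
Qed.

(* Contracting an edge changes the sign of a renumbering of the vertices
   exactly as it changes [sigma]. *)
Lemma merge_perm (tau : 'S_n) i j (ij : i != j) (tij : tau i != tau j) :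
  exists2 t : 'S_n.-1, forall k, t (Defs.merge ij k) = Defs.merge tij (tau k) &
    sigma (tau i) (tau j) * (-1) ^+ t = sigma i j * (-1) ^+ tau.
Proof.
pose M := max_ord i j; pose M' := max_ord (tau i) (tau j).
(* [tau] need not send the disappearing end to the disappearing end. If it does not, exchanging the
   two images, which is invisible after the merger, achieves this and makes [lift_permP]
   applicable. *)
pose tau1 := (tau * (if tau M == M' then 1 else tperm (tau i) (tau j)))%g.
have tau1M : tau1 M = M'.
  rewrite /tau1 permM; case: eqP => [->|]; first by rewrite perm1.
  by rewrite /M /M' /max_ord; do 2!case: ifP => _; rewrite ?tpermL ?tpermR.
have mtau1 k : Defs.merge tij (tau1 k) = Defs.merge tij (tau k).
  rewrite /tau1 permM; case: eqP => _; first by rewrite perm1.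
  by case: tpermP => [->|->|//]; rewrite merge_ends.
have [t tE odd_t] := lift_permP tau1 M; exists t => [k|].
  have main (k' : 'I_n.-1) : t (Defs.merge ij (lift M k')) = Defs.merge tij
    (tau (lift M k')).
    by rewrite merge_lift -mtau1 tE tau1M merge_lift.
  case: (unliftP M k) => [k' -> //|->].
  (* [M] is not a value of [lift M], but the other end [l] is, and it has the same image after the
     merger. *)
  have [l [lM ml]] : exists l, l != M /\ Defs.merge ij M = Defs.merge ij l /\
      Defs.merge tij (tau M) = Defs.merge tij (tau l).
    rewrite /M /max_ord; case: ifP => _; [exists i | exists j]; split=> //.
      by rewrite !merge_ends.
    by rewrite eq_sym.
    by rewrite !merge_ends.
  case: (unliftP M l) lM ml => [l' -> _ [-> ->] //|->]; by rewrite eqxx.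
have odd_tau1 : odd_perm tau1 = odd_perm tau (+) (tau M != M').
  rewrite odd_permM; case: eqP => _; first by rewrite odd_perm1.
  by rewrite odd_tperm tij.
(* [sigma i j] has the parity of [M] plus 1 if [i < j], and [tau M != M'] exactly when [tau]
   reverses the order of [i] and [j]. So the correction of [tau] accounts for the second summand and
   [lift_permP] for the first. *)
rewrite odd_t odd_tau1 tau1M /M /M' /max_ord /sigma.
have tji : tau j != tau i by rewrite eq_sym.
case: (ltngtP i j) => [lt_ij|lt_ij|/val_inj Eij]; last by case/eqP: (ij).
all: case: (ltngtP (tau i) (tau j)) => [lt_t|lt_t|/val_inj Et];
  last by case/eqP: (tij).
all: rewrite /= ?eqxx ?tij ?tji -!exprD; apply: eq_sign; rewrite !oddD /= !oddb.
all: by move: (odd_perm tau) (odd i) (odd j) (odd (tau i)) (odd (tau j));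
  do 5!case.
Qed.

End MergePerm.

Section ContractIsomorphic.
Variables nv ne nt : nat.
Variables (D D' : gdata nv ne nt) (tau : 'S_nv) (pi : 'S_ne).
Variables (eps : {ffun 'I_ne -> bool}) (nu : 'S_nt).
Variables (rho : {ffun 'I_nt -> 'S_3}).
Hypothesis H : relabelled D D' tau pi eps nu rho.
Hypotheses (okD : decorated D) (okD' : decorated D').
Variable e : 'I_ne.
Hypotheses (he : ~~ self_loop D e) (he' : ~~ self_loop D' (pi e)).

(** Three changes balance: the vertex permutation and [sigma] by [merge_perm]; the factor of [e]
    leaves the product over reversed edges; and if [e] is reversed, [sigma] changes sign because its
    arguments are exchanged. *)
Lemma contract_isomorphic : exists2 c,
    isomorphic (contract he) (contract he') c &
  sigma (src D e) (tgt D e) * c =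
  relabel_sign tau eps rho * sigma (src D' (pi e)) (tgt D' (pi e)).
Proof.
have tij : tau (src D e) != tau (tgt D e) by rewrite (inj_eq perm_inj).
have [t tE tsigma] := merge_perm he tij.
have [p pE _] := lift_permP pi e.
have ends := relabelled_ends H e.
have tE' k : t (Defs.merge he k) = Defs.merge he' (tau k).
  rewrite tE; case: (eps e) ends => -[si ti].
    by apply: val_inj; rewrite /= /merge_nat si ti maxnC minnC.
  by apply: val_inj; rewrite /= /merge_nat si ti.
pose ep := [ffun f => eps (lift e f)].
have embE x : flag_emb (pi e) (relabel_flag p ep nu rho x) =
    relabel_flag pi eps nu rho (flag_emb e x).
  by case: x => [//|[f b]] /=; rewrite /relabel_half /= ffunE pE.
have joinE y : flag_join D' (pi e) (relabel_flag pi eps nu rho y) =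
    relabel_flag pi eps nu rho (flag_join D e y).
  case: y => [//|[f b]] /=; rewrite (inj_eq perm_inj); case: eqP => // ->.
  rewrite -(relabelled_mate H) /= /relabel_half /=;
    congr (mate D' (inr (_, _))).
  by case: b; case: (eps e).
exists (relabel_sign t ep rho).
  exists t, p, ep, nu, rho; split=> // x; rewrite -!/(relabel_flag _ _ _ _ _).
  split; first by rewrite !at_C embE (relabelled_at H) tE'.
  apply: (@emb_inj _ _ (pi e)).
  by rewrite emb_mateC // !embE (relabelled_mate H) joinE emb_mateC.
have epE : \prod_f (-1) ^+ eps f = (-1) ^+ eps e * \prod_f (-1) ^+ ep f :> rat.
  by rewrite (bigD1_ord e) //=; congr (_ * _); apply: eq_bigr => f _;
    rewrite ffunE.
have sE : sigma (src D' (pi e)) (tgt D' (pi e)) =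
    (-1) ^+ eps e * sigma (tau (src D e)) (tau (tgt D e)).
  have sC (i j : 'I_nv) : i != j -> sigma j i = - sigma i j.
    rewrite /sigma; case: (ltngtP i j) => [_|_|/val_inj ->] ij /=.
    - by rewrite exprS mulN1r.
    - by rewrite [in RHS]exprS mulN1r opprK.
    - by rewrite eqxx in ij.
  case: (eps e) ends => -[-> ->]; last by rewrite mul1r.
  by rewrite sC // expr1 mulN1r.
have signM (k : nat) : (-1) ^+ k * (-1) ^+ k = 1 :> rat by rewrite -expr2
  sqrr_sign.
have s'E : sigma (tau (src D e)) (tau (tgt D e)) =
    sigma (src D e) (tgt D e) * (-1) ^+ tau * (-1) ^+ t.
  by rewrite -tsigma -mulrA signM mulr1.
rewrite /relabel_sign epE sE s'E; move: (signM tau) (signM (eps e)).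
move: (sigma _ _) ((-1) ^+ t) ((-1) ^+ tau) ((-1) ^+ eps e) => s x y z yy zz.
move: (\prod_f _) (\prod_w _) => b a.
have -> : y * (z * a) * b * (z * (s * y * x)) =
  s * (x * a * b) * (y * y) * (z * z) by ring.
by rewrite yy zz !mulr1.
Qed.

End ContractIsomorphic.

(** * The differential on isomorphic graphs *)

Section Differential.
Variables (R : realType) (g : lieAlgebra R).

Definition has_loop nv ne nt (D : gdata nv ne nt) := [exists e, self_loop D e].

Lemma isomorphic_has_loop nv ne nt (D D' : gdata nv ne nt) c :
  isomorphic D D' c -> has_loop D = has_loop D'.
Proof.
move=> [tau [pi [eps [nu [rho [H _]]]]]]; apply/existsP/existsP => -[e De].
  by exists (pi e); rewrite (relabelled_self_loop H).
by exists ((pi^-1)%g e); rewrite -(relabelled_self_loop H) permKV.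
Qed.

(* The part of the differential spanned by the graphs without self-loops when
   [loops] is false, the whole differential otherwise. *)
Variable loops : bool.

Definition dterm nv ne nt (D : gdata nv ne nt) (e : 'I_ne) : GCfree g :=
  if @idP (~~ self_loop D e) is ReflectT he then
    if loops || ~~ has_loop (contract he)
    then sigma (src D e) (tgt D e) *: gen g (contract he) else 0
  else 0.

Lemma dtermE nv ne nt (D : gdata nv ne nt) e (he : ~~ self_loop D e) :
  dterm D e = if loops || ~~ has_loop (contract he)
    then sigma (src D e) (tgt D e) *: gen g (contract he) else 0.
Proof.
rewrite /dterm; case: {-}_ / idP => [he'|/(_ he)[]].
by rewrite (bool_irrelevance he' he).
Qed.

Lemma dterm0 nv ne nt (D : gdata nv ne nt) e : self_loop D e -> dterm D e = 0.
Proof. by rewrite /dterm; case: {-}_ / idP => // he De; case/negP: (he). Qed.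

Definition dsum nv ne nt (D : gdata nv ne nt) : GCfree g := \sum_e dterm D e.

(** The term at [e] corresponds to the term at [pi e]. Self-loops are preserved by isomorphisms, so
    the truncated differential is respected as well. *)
Lemma isomorphic_dsum nv ne nt (D D' : gdata nv ne nt) c :
  decorated D -> isomorphic D D' c -> gc_eq (dsum D) (c *: dsum D').
Proof.
move=> okD iso; have okD' : decorated D' by rewrite -(isomorphic_decorated iso).
have [tau [pi [eps [nu [rho [H ->]]]]]] := iso.
rewrite /dsum [X in _ *: X](reindex_inj (@perm_inj _ pi)) scaler_sumr.
apply: gc_eq_sum => e _.
have [De|he] := boolP (self_loop D e).
  by rewrite !dterm0 ?(relabelled_self_loop H) // scaler0; apply: gc_eq_refl.
have he' : ~~ self_loop D' (pi e) by rewrite (relabelled_self_loop H).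
have [c' isoC c'E] := contract_isomorphic H okD okD' he he'.
rewrite !(dtermE he) !(dtermE he') (isomorphic_has_loop isoC).
case: (loops || _); last by rewrite gc_scaler0; exact: gc_eq_refl.
apply: gc_eq_trans (gc_eqZ _ (isomorphic_gen g isoC)) _.
by rewrite !gc_scalerA c'E; apply: gc_eq_refl.
Qed.

End Differential.

(** * Trivalent graphs as permutations *)

Lemma gdata_eq nv ne nt (D D' : gdata nv ne nt) :
  src D =1 src D' -> tgt D =1 tgt D' -> own D =1 own D' -> mate D =1 mate D' ->
  D = D'.
Proof.
case: D D' => s t o m [s' t' o' m'] /= /ffunP-> /ffunP->.
by move=> /ffunP-> /ffunP->.
Qed.

Definition gconnected nv ne nt (D : gdata nv ne nt) :=
  [forall v, forall v', connect (graph_adj D) v v'].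

(** The only distinct vertices that get merged are joined by [e], so a path in the contraction
    lifts. *)
Lemma contract_gconnected nv ne nt (D : gdata nv ne nt) e
    (he : ~~ self_loop D e) :
  gconnected (contract he) -> gconnected D.
Proof.
move=> conn.
have adj f : connect (graph_adj D) (src D f) (tgt D f).
  by apply: connect1; apply/existsP; exists f; rewrite !eqxx.
have adjC f : connect (graph_adj D) (tgt D f) (src D f).
  by apply: connect1; apply/existsP; exists f; rewrite !eqxx orbT.
have fibre u u' : Defs.merge he u = Defs.merge he u' ->
  connect (graph_adj D) u u'.
  move/merge_inj => /or3P[/eqP->|/andP[/eqP-> /eqP->]|/andP[/eqP-> /eqP->]] //.
apply/forallP => v; apply/forallP => v'.
have /forallP/(_ (Defs.merge he v'))/connectP[p] := forallP conn (Defs.merge he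
  v).
elim: p v => [|w p IH] v /= =>
  [_ /esym/fibre //|/andP[/existsP[f vw] wp] lastE].
have [x [y [xv yw xy]]] : exists x y, [/\ Defs.merge he v = Defs.merge he x,
    w = Defs.merge he y & connect (graph_adj D) x y].
  move: vw; rewrite /= !ffunE => /orP[] /andP[/eqP<- /eqP<-].
    by exists (src D (lift e f)), (tgt D (lift e f)).
  by exists (tgt D (lift e f)), (src D (lift e f)).
apply: connect_trans (fibre _ _ xv) (connect_trans xy _).
by rewrite yw in wp lastE; apply: IH wp lastE.
Qed.

Section Trivalent.
Variables (nv ne : nat) (kap : halfedge ne -> 'I_nv * 'I_3).
Variable kap' : 'I_nv * 'I_3 -> halfedge ne.
Hypotheses (kapK : cancel kap kap') (kap'K : cancel kap' kap).
Implicit Types (s p u : {perm halfedge ne}) (q : {perm 'I_nv * 'I_3}).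

(* The trivalent graph in which the r-th tree edge at the vertex v ends at the
   half-edge h such that [kap (s h) = (v, r)]. *)
Definition triv s : gdata nv ne nv :=
  GData [ffun e => (kap (s (e, false))).1] [ffun e => (kap (s (e, true))).1]
        [ffun w => w]
        [ffun x => match x with
                   | inl z => inr ((s^-1)%g (kap' z))
                   | inr h => inl (kap (s h))
                   end].

Lemma hend_triv s h : hend (triv s) h = (kap (s h)).1.
Proof. by case: h => e []; rewrite /hend /= ffunE. Qed.

Lemma mate_triv_leaf s h : mate (triv s) (inr h) = inl (kap (s h)).
Proof. by rewrite ffunE. Qed.

Lemma mate_triv_tree s z : mate (triv s) (inl z) = inr ((s^-1)%g (kap' z)).
Proof. by rewrite ffunE. Qed.

Lemma flag_at_triv_tree s (z : 'I_nv * 'I_3) :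
  flag_at (triv s) (inl z) = z.1.
Proof. by rewrite /= ffunE. Qed.

Lemma decorated_triv s : (0 < nv)%N -> gconnected (triv s) ->
  decorated (triv s).
Proof.
move=> nv0 conn.
have mK x : mate (triv s) (mate (triv s) x) = x.
  case: x => [z|h]; first by rewrite mate_triv_tree mate_triv_leaf permKV kap'K.
  by rewrite mate_triv_leaf mate_triv_tree kapK permK.
have atE x : flag_at (triv s) (mate (triv s) x) = flag_at (triv s) x.
  case: x => [z|h]; rewrite ?mate_triv_tree ?mate_triv_leaf.
    by rewrite flag_at_triv_tree /= hend_triv permKV kap'K.
  by rewrite flag_at_triv_tree /= hend_triv.
have valE v : valency (triv s) v = 3%N.
  rewrite /valency -(card_imset _ (inj_comp (can_inj kapK) (@perm_inj _ s))).
  transitivity #|setX [set v] [set: 'I_3]|.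
    apply: eq_card => -[w r]; rewrite !inE /= andbT; apply/imsetP/eqP.
      by case=> h; rewrite inE hend_triv => /eqP <- /= <-.
    move=> ->; exists ((s^-1)%g (kap' (v, r))); last by rewrite /= permKV kap'K.
    by rewrite inE hend_triv permKV kap'K.
  by rewrite cardsX cards1 cardsT card_ord.
apply/and5P; split => //; first by apply/forallP => v; rewrite valE.
  apply/forallP => x; rewrite mK eqxx andbT.
  by case: x => ?; rewrite ?mate_triv_tree ?mate_triv_leaf.
apply/and3P; split.
- by apply/forallP => x; rewrite atE.
- have adj x : connect (tree_adj (triv s)) x (mate (triv s) x).
    by apply: connect1; rewrite /tree_adj eqxx.
  have adjC x : connect (tree_adj (triv s)) (mate (triv s) x) x.
    by have := adj (mate (triv s) x); rewrite mK.
  have tree x : exists z, connect (tree_adj (triv s)) x (inl z) /\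
      connect (tree_adj (triv s)) (inl z) x /\ z.1 = flag_at (triv s) x.
    case: x => [z|h]; first by exists z; rewrite flag_at_triv_tree !connect0.
    exists (kap (s h)); rewrite -mate_triv_leaf adj adjC.
    by rewrite /= hend_triv.
  apply/forallP => x; apply/forallP => y; apply/implyP => /eqP xy.
  have [z [xz [_ zE]]] := tree x; have [z' [_ [z'y z'E]]] := tree y.
  apply: connect_trans xz (connect_trans _ z'y); apply: connect1.
  by rewrite /tree_adj zE z'E xy eqxx orbT.
- apply/forallP => v; rewrite valE (_ : [set w | _] = [set v]) ?cards1 //.
  by apply/setP => w; rewrite !inE ffunE.
Qed.

(** [s] and [s'] lie in one double coset: [p] preserves the edges and [u] the vertices. As a wreath
    permutation over [bool], [p] has the parity of the number of reversed edges; over ['I_3], [u]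
    has the parity of [tau] plus the number of reversed cyclic orders. Comparing signs in [ps']
    gives exactly [relabel_sign]. *)
Lemma isomorphic_triv s s' p u :
    (forall h h', ((p h).1 == (p h').1) = (h.1 == h'.1)) ->
    (forall h h', ((kap (u h)).1 == (kap (u h')).1) = ((kap h).1 == (kap
      h').1)) ->
    (p * s' = s * u)%g ->
  isomorphic (triv s) (triv s') ((-1) ^+ s * (-1) ^+ s').
Proof.
move=> p1 u1 ps'; have [pi [r pE]] := wreathP false p1.
have [|tau [rho uE]] := @wreathP _ _ ord0 (conj_perm kapK kap'K u).
  by move=> x y; rewrite !conj_permE u1 !kap'K.
(* A permutation of [bool] is the addition of its value at [false], and it is odd exactly when this
   value is [true]; hence [r e false] tells whether [e] is reversed. *)
have boolE (t : {perm bool}) b : t b = b (+) t false.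
  case: b => //; have : t true != t false by rewrite (inj_eq perm_inj).
  by case: (t true); case: (t false).
have odd_bool (t : {perm bool}) : odd_perm t = t false.
  case E: (t false).
    have -> : t = tperm false true.
      by apply/permP => b; rewrite boolE E; case: b; rewrite ?tpermL ?tpermR.
    by rewrite odd_tperm.
  have -> : t = 1%g by apply/permP => b; rewrite boolE E addbF perm1.
  by rewrite odd_perm1.
have kapu h : kap (u h) = (tau (kap h).1, rho (kap h).1 (kap h).2).
  by rewrite -wreathE -uE conj_permE kapK.
have s'p h : s' (p h) = u (s h) by rewrite -!permM ps'.
exists tau, pi, [ffun e => r e false], tau, [ffun w => rho w]; split.
  have relE x : relabel_flag pi [ffun e => r e false] tau [ffun w => rho w] x =
      match x with inl z => inl (kap (u (kap' z))) | inr h => inr (p h) end.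
    case: x => [z|h] /=; first by rewrite ffunE kapu kap'K.
    by rewrite /relabel_half ffunE pE wreathE -boolE.
  move=> x; rewrite -!/(relabel_flag _ _ _ _ _) !relE; case: x => [z|h].
    rewrite !flag_at_triv_tree !mate_triv_tree kapu kap'K; split=> //.
    congr inr; apply: (@perm_inj _ s'); rewrite s'p !permKV.
    by apply: (can_inj kapK); rewrite kap'K kapu kap'K.
  rewrite /= !hend_triv !ffunE s'p kapu; split=> //.
  by rewrite kapK kapu.
have := congr1 (@odd_perm _) ps'; rewrite !odd_permM.
rewrite -(odd_conj_perm kapK kap'K u) uE pE !odd_wreath card_bool card_ord /=.
have prodE (I : finType) (b : I -> bool) :
    \prod_i (-1) ^+ b i = (-1) ^+ odd (\sum_i b i) :> rat.
  by rewrite signr_odd expr_sum.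
rewrite /relabel_sign.
rewrite (_ : \prod_e _ = (-1) ^+ odd (\sum_e odd_perm (r e))); last first.
  by rewrite -prodE; apply: eq_bigr => e _; rewrite ffunE odd_bool.
rewrite (_ : \prod_w _ = (-1) ^+ odd (\sum_w odd_perm (rho w))); last first.
  by rewrite -prodE; apply: eq_bigr => w _; rewrite ffunE.
move: (odd_perm s) (odd_perm s') (odd_perm tau) => a b c.
move: (odd (\sum_e _)) (odd (\sum_w _)) => d f.
by move=> E; rewrite -!signr_addb; congr (_ ^+ _); move: E;
  case: a b c d f => [] [] [] [] [].
Qed.

End Trivalent.

(** * The IHX relation *)

Definition tree_flag ne nt (q : 'I_nt * 'I_3 -> 'I_nt * 'I_3) (x : flag ne nt) :
    flag ne nt :=
  match x with inl z => inl (q z) | inr h => inr h end.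

Section TreeFlag.
Variables ne nt : nat.
Implicit Types q : {perm 'I_nt * 'I_3}.

Lemma tree_flag_inj q : injective (@tree_flag ne nt q).
Proof. by move=> [z|h] [z'|h'] // [] /perm_inj ->. Qed.

Definition tree_perm q : {perm flag ne nt} := perm (@tree_flag_inj q).

Lemma tree_permM q q' : tree_perm (q * q')%g = (tree_perm q * tree_perm q')%g.
Proof. by apply/permP => -[z|h]; rewrite permM !permE /= ?permM. Qed.

Lemma tree_perm_tperm z z' : tree_perm (tperm z z') = tperm (inl z) (inl z').
Proof.
have inl_inj' : injective (inl : _ -> flag ne nt) by move=> ? ? [].
apply/permP => -[x|h]; rewrite permE /=; last by rewrite tpermD.
exact: (inj_tperm _ _ _ inl_inj').
Qed.

End TreeFlag.

(** Puts the three terms of an IHX relation side by side when two reindexings leave a sum unchanged,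
    at the price of a division by 3. *)
Lemma average3 (V : lmodType rat) (I : finType) (F G H : I -> V) :
    \sum_i F i = \sum_i G i -> \sum_i F i = \sum_i H i ->
  \sum_i F i = 3%:R^-1 *: \sum_i (F i + G i + H i).
Proof.
move=> FG FH; rewrite !big_split /= -FG -FH.
by rewrite -mulr2n -mulrSr -scaler_nat scalerA mulVf ?scale1r.
Qed.

Section IHX.
Variables (nv ne : nat) (kap : halfedge ne -> 'I_nv * 'I_3).
Variable kap' : 'I_nv * 'I_3 -> halfedge ne.
Hypotheses (kapK : cancel kap kap') (kap'K : cancel kap' kap).
Implicit Types (s p u : {perm halfedge ne}) (q : {perm 'I_nv * 'I_3}).

Local Notation triv := (triv kap kap').

Definition move_flags s q := (s * conj_perm kap'K kapK q)%g.

Lemma move_flagsE s q h : kap (move_flags s q h) = q (kap (s h)).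
Proof. by rewrite permM conj_permE kap'K. Qed.

Section ContractMove.
Variables (s : {perm halfedge ne}) (q : {perm 'I_nv * 'I_3}) (e : 'I_ne).
Hypotheses (he : ~~ self_loop (triv s) e).
Hypothesis (he' : ~~ self_loop (triv (move_flags s q)) e).
Hypotheses (q0 : q (kap (s (e, false))) = kap (s (e, false))).
Hypotheses (q1 : q (kap (s (e, true))) = kap (s (e, true))).
Hypothesis qmerge : forall z, Defs.merge he (q z).1 = Defs.merge he z.1.

Lemma merge_move k : Defs.merge he' k = Defs.merge he k.
Proof. by apply: val_inj; rewrite /= /merge_nat !ffunE !move_flagsE q0 q1. Qed.

Lemma contract_move_src : src (contract he') = src (contract he).
Proof.
apply/ffunP => f; rewrite [LHS]ffunE [RHS]ffunE merge_move.
have -> : src (triv (move_flags s q)) (lift e f) = (q (kap (s (lift e f,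
  false)))).1.
  by rewrite ffunE move_flagsE.
by rewrite qmerge; congr (Defs.merge he _); rewrite ffunE.
Qed.

Lemma contract_move_tgt : tgt (contract he') = tgt (contract he).
Proof.
apply/ffunP => f; rewrite [LHS]ffunE [RHS]ffunE merge_move.
have -> : tgt (triv (move_flags s q)) (lift e f) = (q (kap (s (lift e f,
  true)))).1.
  by rewrite ffunE move_flagsE.
by rewrite qmerge; congr (Defs.merge he _); rewrite ffunE.
Qed.

Lemma contract_move_loop : has_loop (contract he') = has_loop (contract he).
Proof. by rewrite /has_loop /self_loop contract_move_src contract_move_tgt. Qed.

Lemma contract_move_gconnected :
  gconnected (contract he') = gconnected (contract he).
Proof.
by rewrite /gconnected /graph_adj contract_move_src contract_move_tgt.
Qed.

(** [q] fixes the two ends of [e] and moves flags only between vertices that are merged, so the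
    contraction changes only in the way the branches are glued to its trees. *)
Lemma contract_move :
    decorated (triv s) -> decorated (triv (move_flags s q)) ->
  contract he' = reglue (contract he) (tree_perm _ q).
Proof.
move=> okD okD'.
have mateE x : mate (triv (move_flags s q)) (tree_flag q x) =
    tree_flag q (mate (triv s) x).
  case: x => [z|h] /=; last by rewrite !mate_triv_leaf move_flagsE.
  rewrite !mate_triv_tree; congr inr; apply: (@perm_inj _ (move_flags s q)).
  by apply: (can_inj kapK); rewrite permKV move_flagsE permKV !kap'K.
have joinE x : flag_join (triv (move_flags s q)) e (tree_flag q x) =
    tree_flag q (flag_join (triv s) e x).
  case: x => [//|[f b]] /=; case: eqP => // _.
  by rewrite !mate_triv_leaf move_flagsE.
have embE x : flag_emb e (tree_flag q x) = tree_flag q (flag_emb e x).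
  by case: x.
apply: gdata_eq => [f|f|w|x].
- by rewrite contract_move_src.
- by rewrite contract_move_tgt.
- rewrite [LHS]ffunE [RHS]ffunE merge_move; congr (Defs.merge he _).
- have main y : mate (contract he') (tree_perm _ q y) =
      tree_perm _ q (mate (contract he) y).
    rewrite !permE; apply: (@emb_inj _ _ e).
    by rewrite emb_mateC // !embE mateE joinE emb_mateC.
  transitivity (tree_perm _ q (mate (contract he) (((tree_perm _ q)^-1)%g x))).
    by rewrite -main permKV.
  by rewrite [RHS]ffunE.
Qed.

End ContractMove.

Lemma decorated_contract_triv s e (he : ~~ self_loop (triv s) e) :
  decorated (contract he) -> decorated (triv s).
Proof.
case/and5P=> _ conn _ _ _;
  apply: decorated_triv (contract_gconnected conn) => //.
exact: leq_ltn_trans (leq0n _) (ltn_ord (src (triv s) e)).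
Qed.

(** Joining the two tripods along their leaves on [e] creates the inner edge of the IHX relation. *)
Lemma mate_contract_triv s e (he : ~~ self_loop (triv s) e) :
    decorated (triv s) ->
  let x := kap (s (e, false)) in let y := kap (s (e, true)) in
  mate (contract he) (inl (x.1, x.2)) = inl (y.1, y.2).
Proof.
move=> okD x y; have := emb_mateC he okD (inl (x.1, x.2)).
rewrite /flag_emb mate_triv_tree -surjective_pairing kapK permK /= eqxx.
rewrite mate_triv_leaf -surjective_pairing.
by case: (mate (contract he) _) => // z [->].
Qed.

Section Triple.
Variables (R : realType) (g : lieAlgebra R) (loops : bool).
Implicit Types x y z : 'I_nv * 'I_3.

(* The cyclic permutations of three of the four branches at the tree edge
   joining x and y that turn I into H and I into X. *)
Definition ihx_H x y : {perm 'I_nv * 'I_3} :=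
  if x.1 == y.1 then 1%g else
  (tperm (x.1, x.2 + 2%:R) (y.1, y.2 + 1) *
   tperm (x.1, x.2 + 2%:R) (y.1, y.2 + 2%:R))%g.
Definition ihx_X x y : {perm 'I_nv * 'I_3} :=
  if x.1 == y.1 then 1%g else
  (tperm (x.1, x.2 + 2%:R) (y.1, y.2 + 2%:R) *
   tperm (x.1, x.2 + 2%:R) (y.1, y.2 + 1))%g.

(** What the reindexing uses. The condition on all [f] says that only the vertices of [x] and [y]
    are mixed; it is applied to [merge]. Thanks to the identity chosen at self-loops, it holds for
    all [x] and [y]. *)
Definition ihx_perm (Q : 'I_nv * 'I_3 -> 'I_nv * 'I_3 -> {perm 'I_nv * 'I_3}) :=
  forall x y, [/\ Q x y x = x, Q x y y = y, ~~ odd_perm (Q x y) &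
    forall (T : Type) (f : 'I_nv -> T), f x.1 = f y.1 ->
      forall z, f (Q x y z).1 = f z.1].

Lemma ihx_permHX : ihx_perm ihx_H /\ ihx_perm ihx_X.
Proof.
have shift (v : 'I_nv) (r : 'I_3) : ((v, r + 1) == (v, r)) = false /\
    ((v, r + 2%:R) == (v, r)) = false.
  by rewrite !xpair_eqE eqxx; case: (ord3P r) => ->; rewrite !ord3_arith.
have f_tperm x y (T : Type) (f : 'I_nv -> T) : f x.1 = f y.1 ->
    forall z, f (tperm x y z).1 = f z.1.
  by move=> fxy z; case: tpermP => [->|->|].
split=> x y; rewrite /ihx_H /ihx_X; case: eqVneq => [_|xy].
1,3: by split=> [| | |T f _ z]; rewrite ?odd_perm1 ?perm1.
all: have [x1 x2] := shift x.1 x.2; have [y1 y2] := shift y.1 y.2.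
all: have neq r r' : ((x.1, r) == (y.1,
  r')) = false by rewrite xpair_eqE (negPf xy).
all: have neq' r r' : ((y.1, r) == (x.1, r')) = false by rewrite eq_sym neq.
all: rewrite -surjective_pairing in x1 x2; rewrite -surjective_pairing in y1 y2.
all: have neqx r : ((y.1,
  r) == x) = false by rewrite [x]surjective_pairing neq'.
all: have neqy r : ((x.1, r) == y) = false by rewrite [y]surjective_pairing neq.
all: split=> [| | |T f fxy z].
1,5: by rewrite permM !(@tpermD _ _ _ x) ?x1 ?x2 ?neqx.
1,4: by rewrite permM !(@tpermD _ _ _ y) ?y1 ?y2 ?neqy.
1,3: by rewrite odd_permM !odd_tperm !neq.
all: by rewrite permM !f_tperm.
Qed.

(** The move depends on [s], but only through the two slots of [e], which it fixes. They can be read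
    off from the result, and then the move can be undone. *)
Lemma move_flags_inj Q e : ihx_perm Q ->
  injective (fun s => move_flags s (Q (kap (s (e, false))) (kap (s (e,
    true))))).
Proof.
move=> HQ s s' ss'.
have kapE h : Q (kap (s (e, false))) (kap (s (e, true))) (kap (s h)) =
    Q (kap (s' (e, false))) (kap (s' (e, true))) (kap (s' h)).
  by rewrite -!move_flagsE ss'.
have [Q1 Q2 _ _] := HQ (kap (s (e, false))) (kap (s (e, true))).
have [Q1' Q2' _ _] := HQ (kap (s' (e, false))) (kap (s' (e, true))).
have e1 := kapE (e, false); have e2 := kapE (e, true).
rewrite Q1 Q1' in e1; rewrite Q2 Q2' in e2.
apply/permP => h; apply: (can_inj kapK); have := kapE h.
by rewrite e1 e2 => /perm_inj.
Qed.

Lemma self_loop_triv s e :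
  self_loop (triv s) e = ((kap (s (e, false))).1 == (kap (s (e, true))).1).
Proof. by rewrite /self_loop !ffunE. Qed.

(** The ends of [e], hence [sigma], and the self-loops and connectedness of the contraction are
    common to the three graphs. So either all three terms vanish or they form one IHX relator times
    [sigma]. *)
Lemma ihx_triple s e :
  let x := kap (s (e, false)) in let y := kap (s (e, true)) in
  gc_ideal (dterm g loops (triv s) e +
            dterm g loops (triv (move_flags s (ihx_H x y))) e +
            dterm g loops (triv (move_flags s (ihx_X x y))) e).
Proof.
move=> x y; have [HQ XQ] := ihx_permHX.
have [H1 H2 _ Hf] := HQ x y; have [X1 X2 _ Xf] := XQ x y.
have loopH : self_loop (triv (move_flags s (ihx_H x y))) e = self_loop (triv s)
  e.
  by rewrite !self_loop_triv !move_flagsE H1 H2.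
have loopX : self_loop (triv (move_flags s (ihx_X x y))) e = self_loop (triv s)
  e.
  by rewrite !self_loop_triv !move_flagsE X1 X2.
have [De|he] := boolP (self_loop (triv s) e).
  by rewrite !dterm0 ?loopH ?loopX // !addr0; apply: ideal_0.
have heH : ~~ self_loop (triv (move_flags s (ihx_H x y))) e by rewrite loopH.
have heX : ~~ self_loop (triv (move_flags s (ihx_X x y))) e by rewrite loopX.
have xy : x.1 != y.1 by rewrite -self_loop_triv.
have mxy : Defs.merge he x.1 = Defs.merge he y.1.
  have <- : src (triv s) e = x.1 by rewrite ffunE.
  by have <- : tgt (triv s) e = y.1 by [rewrite ffunE]; exact: merge_ends.
have nv0 : (0 < nv)%N by apply: leq_ltn_trans (leq0n _) (ltn_ord x.1).
have {}Hf := Hf _ _ mxy; have {}Xf := Xf _ _ mxy.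
have sigmaE q : q x = x -> q y = y ->
    sigma (src (triv (move_flags s q)) e) (tgt (triv (move_flags s q)) e) =
    sigma x.1 y.1.
  by move=> qx qy; rewrite !ffunE !move_flagsE qx qy.
rewrite (dtermE _ _ he) (dtermE _ _ heH) (dtermE _ _ heX).
rewrite (contract_move_loop heH H1 H2 Hf) (contract_move_loop heX X1 X2 Xf).
case: (loops || _); last by rewrite !addr0; apply: ideal_0.
rewrite !sigmaE // (_ : sigma _ _ = sigma x.1 y.1); last by rewrite !ffunE.
rewrite -!scalerDr; apply: gc_idealZ.
have gconnH := contract_move_gconnected heH H1 H2 Hf.
have gconnX := contract_move_gconnected heX X1 X2 Xf.
have okE q (heq : ~~ self_loop (triv (move_flags s q)) e) :
    gconnected (contract heq) = gconnected (contract he) ->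
    decorated (contract heq) = gconnected (contract he).
  move=> <-; apply/idP/idP; first by case/and5P.
  move=> /contract_gconnected conn; apply: decorated_contract.
  exact: decorated_triv.
have ok1 : decorated (contract he) = gconnected (contract he).
  apply/idP/idP; first by case/and5P.
  move=> /contract_gconnected conn; apply: decorated_contract.
  exact: decorated_triv.
have [conn|nconn] := boolP (gconnected (contract he)); last first.
  rewrite -ok1 in nconn; have nH := nconn; have nX := nconn.
  rewrite ok1 -(okE _ _ gconnH) in nH; rewrite ok1 -(okE _ _ gconnX) in nX.
  rewrite (gen_not_decorated g nconn) (gen_not_decorated g nH).
  by rewrite (gen_not_decorated g nX) !addr0; exact: ideal_0.
rewrite conn in okE ok1.
have okC := okE _ heH (etrans gconnH conn).
have okX := okE _ heX (etrans gconnX conn).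
have ok s' (hs' : ~~ self_loop (triv s') e) : decorated (contract hs') ->
  decorated (triv s').
  exact: decorated_contract_triv.
have HE := contract_move heH H1 H2 Hf (ok _ _ ok1) (ok _ _ okC).
have XE := contract_move heX X1 X2 Xf (ok _ _ ok1) (ok _ _ okX).
have tH : tree_perm ne.-1 (ihx_H x y) =
    (tperm (inl (x.1, x.2 + 2%:R)%R) (inl (y.1, y.2 + 1)%R) *
     tperm (inl (x.1, x.2 + 2%:R)%R) (inl (y.1, y.2 + 2%:R)%R))%g.
  by rewrite /ihx_H (negPf xy) tree_permM !tree_perm_tperm.
have tX : tree_perm ne.-1 (ihx_X x y) =
    (tperm (inl (x.1, x.2 + 2%:R)%R) (inl (y.1, y.2 + 2%:R)%R) *
     tperm (inl (x.1, x.2 + 2%:R)%R) (inl (y.1, y.2 + 1)%R))%g.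
  by rewrite /ihx_X (negPf xy) tree_permM !tree_perm_tperm.
rewrite tH in HE; rewrite tX in XE.
move: (okC) (okX); rewrite HE XE => okC' okX'.
rewrite (gen_decorated g ok1) (gen_decorated g okC') (gen_decorated g okX').
apply: ideal_relator.
have mateC := mate_contract_triv he (ok _ he ok1).
exact: (@rel_ihx R g _ _ _ (contract he) x.1 y.1 x.2 y.2 ok1 okC' okX' xy
  mateC).
Qed.

Lemma dterm_sum_ideal e :
  gc_ideal (\sum_(s : {perm halfedge ne}) (-1) ^+ s *: dterm g loops (triv s)
    e).
Proof.
have [HQ XQ] := ihx_permHX.
pose F (s : {perm halfedge ne}) := (-1) ^+ s *: dterm g loops (triv s) e.
have shiftE Q : ihx_perm Q -> \sum_s F s =
    \sum_(s : {perm halfedge ne}) (-1) ^+ s *: dterm g loops (triv (move_flags s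
      (Q (kap (s (e, false))) (kap (s (e, true)))))) e.
  move=> QP; apply: etrans; first exact: (reindex_inj (@move_flags_inj Q e QP)).
  apply: eq_bigr => s _; rewrite /F.
  have [_ _ /negPf oddQ _] := QP (kap (s (e, false))) (kap (s (e, true))).
  by rewrite odd_permM odd_conj_perm oddQ addbF.
rewrite (average3 (shiftE _ HQ) (shiftE _ XQ)); apply: gc_idealZ.
apply: gc_ideal_sum => s _; rewrite -!scalerDr; apply: gc_idealZ.
exact: ihx_triple.
Qed.

End Triple.
End IHX.

(** * The vertex orientation *)

Lemma nth_flatten_uniform (T : Type) (x : T) k (ss : seq (seq T)) i :
    all (fun s => size s == k) ss -> (0 < k)%N ->
  nth x (flatten ss) i = nth x (nth [::] ss (i %/ k)) (i %% k).
Proof.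
move=> + k0; elim: ss i => [|s ss IH] i /=; first by rewrite !nth_nil.
case/andP=> /eqP sk allk; rewrite nth_cat sk; case: ltnP => [lt_ik|le_ki].
  by rewrite divn_small // modn_small.
by rewrite IH // -(subnK le_ki) addnK divnDr ?dvdnn // divnn k0 addn1 modnDr.
Qed.

Lemma index_edge_order ne (h : halfedge ne) : index h (edge_order ne) = hrank h.
Proof.
have flE : edge_order ne =
    flatten [seq [seq (e, b) | b <- [:: false; true]] | e <- enum 'I_ne] by [].
have nthE : nth h (edge_order ne) (hrank h) = h.
  rewrite flE (@nth_flatten_uniform _ _ 2) //;
    last by apply/allP => s /mapP[e _ ->].
  rewrite /hrank divnD // -muln2 mulnK // modnMl add0n modnMDl.
  have -> : (h.2 %/ 2 = 0)%N by case: (h.2).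
  have -> : (h.2 %% 2 = h.2)%N by case: (h.2).
  have -> : (2 <= h.2)%N = false by case: (h.2).
  rewrite !addn0 (nth_map h.1) ?size_enum_ord // nth_ord_enum.
  by case: (h) => e [].
rewrite -[in LHS]nthE index_uniq ?edge_order_uniq //.
rewrite size_allpairs size_enum_ord /hrank muln2 -[X in (X <= _)%N]addn1.
have := ltn_ord h.1; case: (h.2) => /=; lia.
Qed.

Lemma edge_order_sorted ne : sorted (relpre (@hrank ne) ltn) (edge_order ne).
Proof.
rewrite -sorted_map (_ : map _ _ = iota 0 (size (edge_order ne)))
  ?iota_ltn_sorted //.
case E: (edge_order ne) => [//|h0 r]; rewrite -E.
apply: (@eq_from_nth _ 0%N) => [|i]; rewrite size_map ?size_iota // => lt_i.
rewrite (nth_map h0) // nth_iota // -index_edge_order index_uniq //.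
exact: edge_order_uniq.
Qed.

Section Slots.
Variable n : nat.

Lemma hrank_lt (h : halfedge (3 * n)) : (hrank h < 3 * (2 * n))%N.
Proof. by rewrite /hrank; have := ltn_ord h.1; case: (h.2) => /=; lia. Qed.

Lemma slot_vertex_lt (h : halfedge (3 * n)) : (hrank h %/ 3 < 2 * n)%N.
Proof. by rewrite ltn_divLR //; have := hrank_lt h; lia. Qed.

Lemma slot_rank_lt (h : halfedge (3 * n)) : (hrank h %% 3 < 3)%N.
Proof. by rewrite ltn_mod. Qed.

(* The k-th half-edge corresponds to the (k mod 3)-th position at the vertex
   number k / 3, so that the order of the half-edges becomes the vertex
   orientation. *)
Definition slot (h : halfedge (3 * n)) : 'I_(2 * n) * 'I_3 :=
  (Ordinal (slot_vertex_lt h), Ordinal (slot_rank_lt h)).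

Lemma slot_edge_lt (z : 'I_(2 * n) * 'I_3) : ((3 * z.1 + z.2)./2 < 3 * n)%N.
Proof. by have := ltn_ord z.1; have := ltn_ord z.2; lia. Qed.

Definition unslot (z : 'I_(2 * n) * 'I_3) : halfedge (3 * n) :=
  (Ordinal (slot_edge_lt z), odd (3 * z.1 + z.2)).

Lemma hrank_unslot z : hrank (unslot z) = (3 * z.1 + z.2)%N.
Proof. by rewrite /hrank /= addnC odd_double_half. Qed.

Lemma unslotK : cancel unslot slot.
Proof.
case=> v r; apply/eqP; rewrite xpair_eqE -!val_eqE /= hrank_unslot /=.
rewrite mulnC divnMDl // divn_small ?ltn_ord // addn0 modnMDl modn_small //.
by rewrite !eqxx.
Qed.

Lemma slotK : cancel slot unslot.
Proof.
move=> h; apply: hrank_inj; rewrite hrank_unslot /= [(3 * _)%N]mulnC.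
by rewrite -divn_eq.
Qed.

End Slots.

(** Modulo 3, the translation by [t] is the square of the translation by [2t]. Thus rotating the
    positions at a vertex costs no sign. *)
Lemma odd_translation (t : 'I_3) : odd_perm (perm (@addIr _ t)) = false.
Proof.
suff -> : perm (@addIr _ t) = (perm (@addIr _ (t + t)) * perm (@addIr _ (t +
  t)))%g.
  by rewrite odd_permM addbb.
apply/permP => x; rewrite permM !permE -addrA; congr (_ + _).
by case: (ord3P t) => ->; rewrite ?addr0 // ?ord3_arith.
Qed.

(** * The permutation of a decorated trivalent graph *)

Section CompatibleTrivalent.
Variables (n : nat) (D : gdata (2 * n) (3 * n) (2 * n)).
Hypotheses (okD : decorated D) (compD : compatible D).
Hypothesis valD : forall v, valency D v = 3%N.

Lemma own_unique v : exists2 w, own D w = v & forall w', own D w' = v -> w' = w.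
Proof.
have : #|[set w | own D w == v]| == 1%N.
  case/and5P: okD => _ _ _ _ /and3P[_ _ /forallP/(_ v)].
  by rewrite valD -[3%N]/(1 + 2)%N eqn_add2r eq_sym.
case/cards1P => w wE; exists w => [|w' w'v].
  by have := set11 w; rewrite -wE inE => /eqP.
by apply/set1P; rewrite -wE inE w'v.
Qed.

Lemma own_inj : injective (own D).
Proof.
move=> w w' ww'; have [w0 _ uniq_w0] := own_unique (own D w').
by rewrite (uniq_w0 w) // (uniq_w0 w').
Qed.

(** Two leaves matched with each other would form a whole connected component of the tree, which
    could not contain its trivalent vertex. *)
Lemma mate_leaf h : exists z, mate D (inr h) = inl z.
Proof.
case E: (mate D (inr h)) => [z|h']; first by exists z.
have closed x y : x = inr h \/ x = inr h' -> connect (tree_adj D) x y ->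
    y = inr h \/ y = inr h'.
  move=> hx /connectP[p + ->]; elim: p x hx => [|z p IH] x hx //= /andP[xz].
  apply: IH; case: hx xz => ->; rewrite /tree_adj orbF => /eqP <-.
    by right.
  by left; rewrite -E mateK.
have [w wv _] := own_unique (hend D h).
have : connect (tree_adj D) (inr h) (inl (w, ord0)).
  by apply: tree_conn => //=; rewrite wv.
by case/closed => //; left.
Qed.

(** The default [slot h] never occurs, by [mate_leaf]. *)
Definition leaf_slot h : 'I_(2 * n) * 'I_3 :=
  if mate D (inr h) is inl z then z else slot h.

Lemma mate_leafE h : mate D (inr h) = inl (leaf_slot h).
Proof. by rewrite /leaf_slot; have [z ->] := mate_leaf h. Qed.

Lemma own_leaf_slot h : own D (leaf_slot h).1 = hend D h.
Proof. by have := mate_at okD (inr h); rewrite mate_leafE. Qed.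

Lemma trivalent_perm_inj :
  injective (fun h => unslot (own D (leaf_slot h).1, (leaf_slot h).2)).
Proof.
move=> h h' /(can_inj (@unslotK n)) [/own_inj e1 e2].
have : mate D (inr h) = mate D (inr h').
  by rewrite !mate_leafE [leaf_slot h]surjective_pairing e1 e2
    -surjective_pairing.
by move/(can_inj (mateK okD)) => [].
Qed.

(** Its graph is [D] with each tree vertex renamed as its owner; such a renaming carries no sign. *)
Definition trivalent_perm : {perm halfedge (3 * n)} := perm trivalent_perm_inj.

Lemma slot_trivalent_perm h :
  slot (trivalent_perm h) = (own D (leaf_slot h).1, (leaf_slot h).2).
Proof. by rewrite permE unslotK. Qed.

Lemma mate_tree z : exists2 h, mate D (inl z) = inr h & leaf_slot h = z.
Proof.
pose h := (trivalent_perm^-1)%g (unslot (own D z.1, z.2)).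
have hz : leaf_slot h = z.
  have := slot_trivalent_perm h; rewrite permKV unslotK => -[/own_inj z1 z2].
  by rewrite [LHS]surjective_pairing -z1 -z2 -surjective_pairing.
by exists h => //; rewrite -hz -mate_leafE mateK.
Qed.

Lemma isomorphic_trivalent_perm :
  isomorphic D (triv (@slot n) (@unslot n) trivalent_perm) 1.
Proof.
exists 1%g, 1%g, [ffun=> false], (perm own_inj), [ffun=> 1%g]; split.
  have relE x : relabel_flag 1 [ffun=> false] (perm own_inj) [ffun=> 1%g] x =
      match x with inl z => inl (own D z.1, z.2) | inr h => inr h end.
    case: x => [z|[e b]] /=; first by rewrite ffunE permE perm1.
    by rewrite /relabel_half /= ffunE perm1 addbF.
  move=> x; rewrite -!/(relabel_flag _ _ _ _ _) !relE perm1.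
  case: x => [z|h].
    rewrite flag_at_triv_tree mate_triv_tree; split=> //.
    have [h -> hz] := mate_tree z; congr inr;
      apply: (@perm_inj _ trivalent_perm).
    by apply: (can_inj (@slotK n));
      rewrite permKV unslotK slot_trivalent_perm hz.
  rewrite /= hend_triv mate_triv_leaf slot_trivalent_perm own_leaf_slot.
  by rewrite mate_leafE own_leaf_slot.
rewrite /relabel_sign odd_perm1 !big1 ?mulr1 // => i _; rewrite ffunE //.
by rewrite odd_perm1.
Qed.

(** Compatibility makes the order of the half-edges at [v] a rotation of the positions in the
    tripod; [t] is that rotation. *)
Lemma vertex_block v : exists (a : 'I_3 -> halfedge (3 * n)) (t : 'I_3),
  [seq h <- edge_order (3 * n) | hend D h == v] = [:: a 0; a 1; a 2%:R] /\
  forall r, slot (trivalent_perm (a r)) = (v, r + t).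
Proof.
have [w wv _] := own_unique v.
pose a r := if mate D (inl (w, r)) is inr h then h else unslot (w, r).
have mateE r : mate D (inl (w, r)) = inr (a r).
  by rewrite /a; have [h -> _] := mate_tree (w, r).
have aE r : leaf_slot (a r) = (w, r).
  by have := mate_leafE (a r); rewrite -mateE mateK // => -[<-].
have [t lt1 lt2] := compD.2 w a mateE.
exists (fun r => a (r + t)), t; split; last first.
  by move=> r; rewrite slot_trivalent_perm aE wv.
have hrank_trans : transitive (relpre (@hrank (3 * n)) ltn).
  by move=> x y z; apply: ltn_trans.
apply: (irr_sorted_eq hrank_trans) => [x|||h]; first exact: ltnn.
- exact/sorted_filter/edge_order_sorted.
- by rewrite /= add0r ![_ + t]addrC lt1 lt2.
rewrite mem_filter mem_edge_order andbT !inE -own_leaf_slot -wv (inj_eq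
  own_inj).
apply/eqP/or3P => [hw|].
  have : h = a (leaf_slot h).2.
    have [] : inr h = inr (a (leaf_slot h).2) :> flag (3 * n) (2 * n) by
      rewrite -mateE -hw -surjective_pairing -mate_leafE mateK.
    by [].
  have -> : (leaf_slot h).2 = ((leaf_slot h).2 - t) + t by rewrite subrK.
  move: (_ - t) => r ->; case: (ord3P r) => ->;
    [constructor 1 | constructor 2 | constructor 3];
  exact: eqxx.
by case=> /eqP ->; rewrite aE.
Qed.

(** Read on slots, the change of orientation followed by [trivalent_perm] fixes each vertex and
    rotates its positions. This product is even, so the two factors have the same parity. *)
Lemma or_sign_trivalent_perm : or_sign D = (-1) ^+ trivalent_perm.
Proof.
rewrite /or_sign; set P := perm _; congr (_ ^+ _); congr (nat_of_bool _).
have [t tE] : exists t : {ffun 'I_(2 * n) -> 'I_3}, forall h,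
    slot (trivalent_perm (P h)) = ((slot h).1, (slot h).2 + t (slot h).1).
  have /fin_all_exists[t tP] : forall v, exists t : 'I_3, exists a : 'I_3 ->
    halfedge (3 * n),
      [seq h <- edge_order (3 * n) | hend D h == v] = [:: a 0; a 1; a 2%:R] /\
      forall r, slot (trivalent_perm (a r)) = (v, r + t).
    by move=> v; have [a [t H]] := vertex_block v; exists t, a.
  exists (finfun t) => h; rewrite ffunE /P permE /order_change index_edge_order.
  rewrite /vertex_order (@nth_flatten_uniform _ _ 3) //; last first.
    by apply/allP => _ /mapP[v _ ->]; have [a [-> _]] := tP v.
  rewrite (nth_map (slot h).1) ?size_enum_ord ?slot_vertex_lt //.
  have -> : nth (slot h).1 (enum 'I_(2 * n)) (hrank h %/ 3) = (slot h).1.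
    exact: (nth_ord_enum _ (slot h).1).
  have [a [-> aE]] := tP (slot h).1.
  have -> : nth h [:: a 0; a 1; a 2%:R] (hrank h %% 3) = a (slot h).2.
    by rewrite -[(hrank h %% 3)%N]/(val (slot h).2);
      case: (ord3P (slot h).2) => ->.
  exact: aE.
apply: addIb (odd_perm trivalent_perm) _ _ _; rewrite addbb -odd_permM.
rewrite -(odd_conj_perm (@slotK n) (@unslotK n)).
suff -> : conj_perm (@slotK n) (@unslotK n) (P * trivalent_perm)%g =
    wreath 1 (fun v => perm (@addIr _ (t v))).
  rewrite odd_wreath odd_perm1 andbF big1 // => v _.
  by rewrite odd_translation.
apply/permP => -[v r]; rewrite conj_permE permM tE unslotK wreathE /=.
by rewrite perm1 permE.
Qed.

End CompatibleTrivalent.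

(** * Counting topological graphs *)

Section Partitions.
Variable X : finType.
Implicit Types (P : {set {set X}}) (s : {perm X}).

Lemma mem_pblockT P x y : partition P [set: X] ->
  (y \in pblock P x) = (pblock P x == pblock P y).
Proof.
by move=> /and3P[/eqP cP tP _]; rewrite eq_pblock // cP inE.
Qed.

Lemma partition_blocksT P : partition P [set: X] ->
  P = [set pblock P x | x : X].
Proof.
move=> PP; have /and3P[/eqP cP tP P0] := PP.
apply/setP => B; apply/idP/imsetP => [BP|[x _ ->]].
  have /set0Pn[x xB] : B != set0 by apply: contraNneq P0 => <-.
  by exists x; rewrite // (def_pblock tP BP xB).
by apply: pblock_mem; rewrite cP inE.
Qed.

(** Partitions are traded for their equivalence relations, which pull back along bijections. *)
Lemma partition_carriesP P P' s :
    partition P [set: X] -> partition P' [set: X] ->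
  reflect (forall x y, (pblock P x == pblock P y) =
                       (pblock P' (s x) == pblock P' (s y)))
          ([set [set s x | x in B : {set _}] | B in P] == P').
Proof.
move=> PP PP'; have /and3P[/eqP cP tP P0] := PP.
have /and3P[/eqP cP' tP' P0'] := PP'.
have imset_inj' := imset_inj (@perm_inj _ s).
apply: (iffP eqP) => [E x y | H].
  have blockE z : pblock P' (s z) = s @: pblock P z.
    apply: def_pblock => //; last by rewrite imset_f // mem_pblock cP inE.
    by rewrite -E imset_f // pblock_mem // cP inE.
  by rewrite !blockE (inj_eq imset_inj').
have blockE x : pblock P' (s x) = s @: pblock P x.
  apply/setP => y; rewrite -(permKV s y) (mem_imset _ _ (@perm_inj _ s)).
  by rewrite !mem_pblockT // H.
apply/setP => B; rewrite [in RHS](partition_blocksT PP').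
apply/imsetP/imsetP => [[A]|[y _ ->]].
  rewrite {1}(partition_blocksT PP) => /imsetP[x _ ->] ->.
  by exists (s x); rewrite // blockE.
exists (pblock P ((s^-1)%g y)); last by rewrite -blockE permKV.
by apply: pblock_mem; rewrite cP inE.
Qed.

End Partitions.

(** * Frames of a topological graph and the orbit count *)

Section Frames.
Variable n : nat.
Implicit Types (T : topgraph n) (s w u : {perm halfedge (3 * n)}).
Implicit Types (f : {ffun 'I_(6 * n) -> halfedge (3 * n)}).

Definition same_edge T x y := pblock (tg_edges T) x == pblock (tg_edges T) y.
Definition same_vert T x y := pblock (tg_verts T) x == pblock (tg_verts T) y.

Lemma tg_partition T :
  partition (tg_edges T) [set: 'I_(6 * n)] /\ partition (tg_verts T) [set:
    'I_(6 * n)].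
Proof. by have /and4P[] := valP T. Qed.

Lemma tg_carriesP T T' (p : {perm 'I_(6 * n)}) :
  reflect ((forall x y, same_edge T x y = same_edge T' (p x) (p y)) /\
           (forall x y, same_vert T x y = same_vert T' (p x) (p y)))
          (tg_carries p T T').
Proof.
have [eP vP] := tg_partition T; have [eP' vP'] := tg_partition T'.
by apply: (iffP andP) =>
  -[/(partition_carriesP p eP eP')? /(partition_carriesP p vP vP')?].
Qed.

Definition edge_frame T f : bool :=
  injectiveb f && [forall x, forall y, same_edge T x y == ((f x).1 == (f y).1)].

(* The trivalent graph of s becomes T when its half-edges are named by f. *)
Definition framed T s f : bool :=
  edge_frame T f &&
  [forall x, forall y, same_vert T x y == ((slot (s (f x))).1 == (slot (s (f
    y))).1)].

Definition represents T s : bool := [exists f, framed T s f].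

(** With [slot_perms], the two groups acting in the double cosets: edges are renumbered and
    reversed, vertices renumbered and their positions permuted. *)
Definition edge_perms :=
  [set w : {perm halfedge (3 * n)} | [forall x, forall y,
    ((w x).1 == (w y).1) == (x.1 == y.1)]].
Definition slot_perms :=
  [set u : {perm halfedge (3 * n)} | [forall x, forall y,
     ((slot (u x)).1 == (slot (u y)).1) == ((slot x).1 == (slot y).1)]].

Lemma forall2P (A B : finType) (P Q : A -> B -> bool) :
  reflect (forall x y, P x y = Q x y) [forall x, forall y, P x y == Q x y].
Proof.
apply: (iffP forallP) => H x; last by apply/forallP => y; rewrite H.
by move=> y; have /forallP/(_ y)/eqP := H x.
Qed.

Lemma edge_frameP T f : reflect
  (injective f /\ forall x y,
    same_edge T x y = ((f x).1 == (f y).1)) (edge_frame T f).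
Proof. by apply: (iffP andP) => -[/injectiveP? /forall2P?]. Qed.

Lemma framedP T s f : reflect
  [/\ injective f, forall x y, same_edge T x y = ((f x).1 == (f y).1) &
    forall x y, same_vert T x y = ((slot (s (f x))).1 == (slot (s (f y))).1)]
  (framed T s f).
Proof.
apply: (iffP andP) => [[/edge_frameP[? ?] /forall2P ?] //|[fi fe /forall2P fv]].
by split=> //; apply/edge_frameP.
Qed.

Lemma card_flags : #|'I_(6 * n)| = #|halfedge (3 * n)|.
Proof. by rewrite card_prod !card_ord card_bool; lia. Qed.

Lemma frame_inv f : injective f -> exists2 f', cancel f f' & cancel f' f.
Proof.
by move=> fi; have [f' ? ?] := inj_card_bij fi (eq_leq (esym card_flags));
  exists f'.
Qed.

Lemma card_edge_frames T f0 : edge_frame T f0 ->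
  #|[set f | edge_frame T f]| = #|edge_perms|.
Proof.
move=> /edge_frameP[f0i f0e]; have [f0' f0K f0'K] := frame_inv f0i.
pose F w := [ffun x => w (f0 x)].
have Finj : injective F.
  move=> w w' /ffunP E; apply/permP => h.
  by have := E (f0' h); rewrite !ffunE f0'K.
rewrite -[RHS](card_imset _ Finj); apply: eq_card => f; rewrite inE.
apply/edge_frameP/imsetP => [[fi fe]|[w]]; last first.
  rewrite inE => /forall2P we ->; split=> [x y|x y]; rewrite !ffunE.
    by move/perm_inj/f0i.
  by rewrite we f0e.
have winj : injective (fun h => f (f0' h)).
  by move=> h h' /fi/(can_inj f0'K).
exists (perm winj); last by apply/ffunP => x; rewrite ffunE permE f0K.
by rewrite inE; apply/forall2P => h h'; rewrite !permE -fe f0e !f0'K.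
Qed.

Lemma card_framed_perms T s0 f0 f : framed T s0 f0 -> edge_frame T f ->
  #|[set s | framed T s f]| = #|slot_perms|.
Proof.
move=> /framedP[f0i f0e f0v] ef; have /edge_frameP[fi fe] := ef.
have [f0' f0K f0'K] := frame_inv f0i; have [f' fK f'K] := frame_inv fi.
(* [s0] transported from the frame [f0] to the frame [f]; it represents the coset of [slot_perms]
   that is counted. *)
have winj : injective (fun h => s0 (f0 (f' h))).
  by move=> h h' /perm_inj/f0i/(can_inj f'K).
rewrite -[RHS](card_lcoset _ (perm winj)); apply: eq_card => s;
  rewrite inE mem_lcoset inE.
rewrite /framed ef /=; apply/forall2P/forall2P => H h h'.
  have main k k' : ((slot (s k)).1 == (slot (s k')).1) =
      ((slot (perm winj k)).1 == (slot (perm winj k')).1).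
    by rewrite !permE -f0v H !f'K.
  by have := main ((perm winj)^-1 h)%g ((perm winj)^-1 h')%g;
    rewrite !permKV -!permM.
have := H (perm winj (f h)) (perm winj (f h')).
by rewrite !permM !permK => ->; rewrite !permE !fK f0v.
Qed.

Lemma card_frames T s f0 : framed T s f0 ->
  #|[set f | framed T s f]| = #|tg_aut T|.
Proof.
move=> /framedP[f0i f0e f0v]; have [f0' f0K f0'K] := frame_inv f0i.
pose F (a : {perm 'I_(6 * n)}) := [ffun x => f0 (a x)].
have Finj : injective F.
  move=> a a' /ffunP E; apply/permP => x.
  by have := E x; rewrite !ffunE => /f0i.
rewrite -[RHS](card_imset _ Finj); apply: eq_card => f; rewrite inE.
apply/framedP/imsetP => [[fi fe fv]|[a]]; last first.
  rewrite inE => /tg_carriesP[ae av ->]; split=> x y; rewrite !ffunE.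
  - by move/f0i/perm_inj.
  - by rewrite ae f0e.
  - by rewrite av f0v.
have ainj : injective (fun x => f0' (f x)).
  by move=> x y /(can_inj f0'K)/fi.
exists (perm ainj); last by apply/ffunP => x; rewrite ffunE permE f0'K.
rewrite inE; apply/tg_carriesP; split=> x y; rewrite !permE.
  by rewrite [RHS]f0e !f0'K fe.
by rewrite [RHS]f0v !f0'K fv.
Qed.

(** The pairs of a permutation [s] and a frame [f] are counted twice. For fixed [s] the frames form
    a torsor under the automorphisms of [T]; all edge frames form one under [edge_perms], and for
    each of them the permutations form a coset of [slot_perms]. *)
Lemma card_represents T s0 : represents T s0 ->
  (#|[set s | represents T s]| * #|tg_aut T| = #|edge_perms| * #|slot_perms|)%N.
Proof.
case/existsP=> f0 H0; have /andP[e0 _] := H0.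
rewrite -(card_edge_frames e0) -!sum_nat_const.
transitivity (\sum_(s in [set s | represents T s]) \sum_(f | framed T s f) 1)%N.
  apply: eq_bigr => s; rewrite inE => /existsP[f sf].
  by rewrite sum1dep_card (card_frames sf).
rewrite (exchange_big_dep (fun f => f \in [set f | edge_frame T f])) /=;
  last first.
  by move=> s f _ /andP[]; rewrite inE.
apply: eq_bigr => f; rewrite inE => ef.
rewrite -(card_framed_perms H0 ef) -sum1_card; apply: eq_bigl => s.
by rewrite !inE andb_idl // => sf; apply/existsP; exists f.
Qed.

Lemma represents_iso T T' s : represents T s -> represents T' s -> tg_iso T T'.
Proof.
case/existsP=> f /framedP[fi fe fv] /existsP[f' /framedP[fi' fe' fv']].
have [g fK gK] := frame_inv fi; have [g' fK' gK'] := frame_inv fi'.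
have pinj : injective (fun x => g' (f x)) by move=> x y /(can_inj gK')/fi.
apply/existsP; exists (perm pinj); apply/tg_carriesP; split=> x y;
  rewrite !permE.
  by rewrite fe fe' !gK'.
by rewrite fv fv' !gK'.
Qed.

Lemma iso_represents T T' s : tg_iso T T' -> represents T s -> represents T' s.
Proof.
case/existsP=> p /tg_carriesP[pe pv] /existsP[f /framedP[fi fe fv]].
apply/existsP; exists [ffun x => f ((p^-1)%g x)]; apply/framedP.
split=> x y; rewrite !ffunE; first by move/fi/perm_inj.
  by rewrite -fe pe !permKV.
by rewrite -fv pv !permKV.
Qed.

Lemma tg_iso_equivalence : {in [set: topgraph n] & &,
  equivalence_rel (@tg_iso n)}.
Proof.
have refl T : tg_iso T T.
  by apply/existsP; exists 1%g; apply/tg_carriesP; split=> x y; rewrite !perm1.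
have sym T T' : tg_iso T T' -> tg_iso T' T.
  case/existsP=> p /tg_carriesP[pe pv]; apply/existsP; exists (p^-1)%g.
  by apply/tg_carriesP; split=> x y; rewrite ?pe ?pv !permKV.
have trans T1 T2 T3 : tg_iso T1 T2 -> tg_iso T2 T3 -> tg_iso T1 T3.
  case/existsP=> p /tg_carriesP[pe pv] /existsP[q /tg_carriesP[qe qv]].
  apply/existsP; exists (p * q)%g.
  by apply/tg_carriesP; split=> x y; rewrite !permM ?pe ?pv ?qe ?qv.
move=> T1 T2 T3 _ _ _; split=> // T12; apply/idP/idP; last exact: trans.
exact/trans/sym.
Qed.

Lemma iso_representativesP (X P : {set topgraph n}) T :
    iso_representatives X P -> T \in P ->
  exists2 T0, T0 \in X & forall T1, T1 \in X -> tg_iso T T1 = (T1 == T0).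
Proof.
case/and3P=> _ XP /forallP trX TP.
have eqiP : {in P & &, equivalence_rel (@tg_iso n)}.
  by move=> T1 T2 T3 _ _ _; apply: tg_iso_equivalence; rewrite inE.
have /implyP/(_ (imset_f _ TP))/cards1P[T0 T0E] := trX [set y in P | tg_iso T
  y].
have memE T1 : (T1 \in X) && tg_iso T T1 = (T1 == T0).
  have := in_setI T1 X [set y in P | tg_iso T y]; rewrite T0E !inE => ->.
  by case: (boolP (T1 \in X)) => //= /(subsetP XP) ->.
have /andP[T0X _] : (T0 \in X) && tg_iso T T0 by rewrite memE.
by exists T0 => // T1 T1X; rewrite -memE T1X.
Qed.

End Frames.

Lemma card_fst_fibre (X A B : finType) (f : X -> A * B) a :
  bijective f -> #|[set x | (f x).1 == a]| = #|B|.
Proof.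
move=> [f' fK f'K]; rewrite -(card_imset _ (can_inj fK)).
transitivity #|setX [set a] [set: B]|;
  last by rewrite cardsX cards1 cardsT mul1n.
apply: eq_card => -[a' b]; rewrite !inE andbT; apply/imsetP/eqP => /= [[x]|->].
  by rewrite inE => /eqP <- <-.
by exists (f' (a, b)); rewrite ?inE f'K.
Qed.

Section FibrePartition.
Variables (X A B : finType) (f : X -> A * B).
Hypothesis f_bij : bijective f.

Definition fibre_partition := preim_partition (fun x => (f x).1) [set: X].

Lemma fibre_partitionP : partition fibre_partition [set: X].
Proof. exact: preim_partitionP. Qed.

Lemma pblock_fibre x y :
  (pblock fibre_partition x == pblock fibre_partition y) = ((f x).1 == (f y).1).
Proof.
rewrite -mem_pblockT ?fibre_partitionP // pblock_equivalence_partition ?inE //.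
by move=> x1 x2 x3 _ _ _; split=> // /eqP->.
Qed.

Lemma card_fibre_partition C : C \in fibre_partition -> #|C| = #|B|.
Proof.
move=> /imsetP[x _ ->]; rewrite -(card_fst_fibre (f x).1 f_bij);
  apply: eq_card => y.
by rewrite !inE eq_sym.
Qed.

End FibrePartition.

(** * The topological graph of a permutation *)

Section Realization.
Variable n : nat.
Variable s : {perm halfedge (3 * n)}.

(** With half-edges named by an enumeration, edges and vertices are the fibres of first projections,
    of sizes [#|bool| = 2] and [#|'I_3| = 3]. *)
Lemma topgraph_of_perm : exists T : topgraph n, represents T s.
Proof.
pose f (x : 'I_(6 * n)) : halfedge (3 * n) := enum_val (cast_ord (etrans (esym
  (card_ord _)) (card_flags n)) x).
have fi : injective f by move=> x y /enum_val_inj/cast_ord_inj.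
have f_bij : bijective f by apply: inj_card_bij => //; rewrite card_flags.
have sf_bij : bijective (fun x => slot (s (f x))).
  apply: inj_card_bij; first by move=> x y /(can_inj (@slotK n))/perm_inj/fi.
  by rewrite card_prod !card_ord; lia.
have triv_ok : trivalent (fibre_partition f, fibre_partition (fun x =>
  slot (s (f x)))).
  apply/and4P; split; rewrite /= ?fibre_partitionP //.
    by apply/forall_inP => C /(card_fibre_partition f_bij) ->;
      rewrite card_bool.
  by apply/forall_inP => C /(card_fibre_partition sf_bij) ->; rewrite card_ord.
exists (exist (fun p => is_true (@trivalent n p)) _ triv_ok); apply/existsP;
  exists (finfun f); apply/framedP.
split=> x y; rewrite ?ffunE; first exact: fi.
  exact: pblock_fibre.
exact: (pblock_fibre (fun x => slot (s (f x)))).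
Qed.

Variable T : topgraph n.
Hypothesis Ts : represents T s.

Local Notation D := (triv (@slot n) (@unslot n) s).

Lemma represents_connected : gconnected D -> tg_connected T.
Proof.
move=> conn; have /existsP[f /framedP[fi fe fv]] := Ts.
have [f' fK f'K] := frame_inv fi; have [eP vP] := tg_partition T.
have edge_adj x y : same_edge T x y -> connect (fun a b =>
     [exists B in tg_edges T :|: tg_verts T, (a \in B) && (b \in B)]) x y.
  move=> xy; apply: connect1; apply/exists_inP; exists (pblock (tg_edges T) x).
    by rewrite inE pblock_mem // (cover_partition eP) inE.
  by rewrite !mem_pblockT // eqxx; exact: xy.
have vert_adj x y : same_vert T x y -> connect (fun a b =>
     [exists B in tg_edges T :|: tg_verts T, (a \in B) && (b \in B)]) x y.
  move=> xy; apply: connect1; apply/exists_inP; exists (pblock (tg_verts T) x).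
    by rewrite inE pblock_mem ?orbT // (cover_partition vP) inE.
  by rewrite !mem_pblockT // eqxx; exact: xy.
apply/forallP => x; apply/forallP => y.
have /forallP/(_ (slot (s (f y))).1)/connectP[p] := forallP conn (slot (s (f
  x))).1.
elim: p x => [|v p IH] x => [_ xy|/andP[/existsP[e xv] vp] lastE].
  by apply: vert_adj; rewrite fv xy eqxx.
have [b [xb vb]] : exists b, (slot (s (f x))).1 = (slot (s (e, b))).1 /\
    v = (slot (s (e, ~~ b))).1.
  move: xv; rewrite !ffunE => /orP[] /andP[/eqP<- /eqP<-].
    by exists false.
  by exists true.
apply: connect_trans (vert_adj x (f' (e, b)) _) _.
  by rewrite fv f'K xb.
apply: connect_trans (edge_adj _ (f' (e, ~~ b)) _) _.
  by rewrite fe !f'K.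
by apply: IH; rewrite f'K -vb.
Qed.

Lemma represents_self_loop : tg_self_loop T -> has_loop D.
Proof.
have /existsP[f /framedP[fi fe fv]] := Ts.
have [f' fK f'K] := frame_inv fi; have [eP vP] := tg_partition T.
case/exists_inP=> B BE /exists_inP[A AV sBA].
have [x xB] : exists x, x \in B.
  by apply/set0Pn; have /and3P[_ _] := eP; apply: contraNneq => <-.
have /and3P[_ tE _] := eP; have /and3P[_ tV _] := vP.
have BE' := def_pblock tE BE xB.
pose y := f' ((f x).1, ~~ (f x).2).
have yB : y \in B by rewrite -BE' mem_pblockT // -/(same_edge T x y) fe f'K
  eqxx.
have xA := subsetP sBA _ xB; have yA := subsetP sBA _ yB.
have : same_vert T x y.
  by rewrite /same_vert (def_pblock tV AV xA) (def_pblock tV AV yA).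
rewrite fv f'K => xy; apply/existsP; exists (f x).1; rewrite self_loop_triv.
move: xy; case: (f x) => e [] /=; by rewrite // eq_sym.
Qed.

End Realization.

Section Contraction.
Variables (nv ne nt : nat) (D : gdata nv ne nt).

Lemma contract_has_loop e (he : ~~ self_loop D e) :
  has_loop D -> has_loop (contract he).
Proof.
case/existsP=> f Df; case: (unliftP e f) Df => [f' -> Df|->];
  last by rewrite (negPf he).
apply/existsP; exists f'; rewrite /self_loop !ffunE.
by move/eqP: Df => ->.
Qed.

End Contraction.

(** A disconnected graph has no connected contraction, and a self-loop survives the contraction of
    another edge. So the permutations excluded from the sum over graphs may be added freely. *)
Lemma dsum_triv0 nv ne (kap : halfedge ne -> 'I_nv * 'I_3) kap'
    (R : realType) (g : lieAlgebra R) loops s :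
    cancel kap kap' -> cancel kap' kap ->
    ~~ (gconnected (triv kap kap' s) && (loops || ~~ has_loop (triv kap kap'
      s))) ->
  dsum g loops (triv kap kap' s) = 0.
Proof.
move=> kapK kap'K nok; apply: big1 => e _.
have [De|he] := boolP (self_loop (triv kap kap' s) e); first exact: dterm0.
rewrite (dtermE _ _ he).
have [okC|nokC] := boolP (decorated (contract he)); last first.
  by rewrite gen_not_decorated // gc_scaler0; case: (loops || _).
have : gconnected (triv kap kap' s).
  by case/and5P: okC => _ conn _ _ _; apply: contract_gconnected conn.
move=> conn; rewrite conn /= in nok.
have -> : (loops || ~~ has_loop (contract he)) = false; last by [].
move: nok; rewrite negb_or negbK => /andP[/negPf -> loopD] /=.
by rewrite (contract_has_loop he loopD).
Qed.

(** * The cocycle *)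

Section LinearExtension.
Variables (K : choiceType) (V : lmodType rat) (F : K -> V).
Implicit Types x y : {malg rat[K]}.

(** [delta] is the instance with [F] given by [delta_word], so its linearity is obtained here. *)
Definition linear_ext x : V := \sum_(m <- msupp x) mcoeff m x *: F m.

Lemma linear_extw x (d : {fset K}) : (msupp x `<=` d)%fset ->
  linear_ext x = \sum_(m <- d) mcoeff m x *: F m.
Proof.
move=> xd; apply: big_fset_incl => // m _ mx.
by rewrite (mcoeff_outdom mx) scale0r.
Qed.

Lemma linear_extD x y : linear_ext (x + y) = linear_ext x + linear_ext y.
Proof.
rewrite (linear_extw (msuppD_le x y)) (linear_extw (fsubsetUl _ (msupp y))).
rewrite (linear_extw (fsubsetUr (msupp x) _)) -big_split /=.
by apply: eq_bigr => m _; rewrite mcoeffD scalerDl.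
Qed.

Lemma linear_extZ c x : linear_ext (c *: x) = c *: linear_ext x.
Proof.
rewrite (linear_extw (msuppZ_le c x)) scaler_sumr; apply: eq_bigr => m _.
by rewrite mcoeffZ scalerA.
Qed.

Lemma linear_extU m : linear_ext (mkmalgU m 1) = F m.
Proof. by rewrite /linear_ext msuppU oner_eq0 big_seq_fset1 mcoeffUU scale1r.
  Qed.

Lemma linear_ext_sum (I : finType) (P : pred I) (c : I -> rat) (k : I -> K) :
  linear_ext (\sum_(i | P i) c i *: mkmalgU (k i) 1) =
  \sum_(i | P i) c i *: F (k i).
Proof.
have ext0 : linear_ext 0 = 0 by rewrite /linear_ext msupp0 big_seq_fset0.
rewrite (big_morph _ linear_extD ext0); apply: eq_bigr => i _.
by rewrite linear_extZ linear_extU.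
Qed.

Lemma msupp_sum (I : Type) (r : seq I) (P : pred I) (G : I -> {malg rat[K]})
    (Q : K -> Prop) :
  (forall i, P i -> forall m, m \in msupp (G i) -> Q m) ->
  forall m, m \in msupp (\sum_(i <- r | P i) G i) -> Q m.
Proof.
move=> GQ; elim/big_rec: _ => [m|i x Pi IH m]; first by rewrite msupp0.
by move/(fsubsetP (msuppD_le _ _)); rewrite in_fsetU => /orP[/(GQ _ Pi)|/IH].
Qed.

Lemma msupp_scale c x m : m \in msupp (c *: x) -> m \in msupp x.
Proof. exact: (fsubsetP (msuppZ_le c x)). Qed.

End LinearExtension.

(** Used for [I] the topological graphs, [A] the representatives and [J] the permutations: a
    contributing permutation represents exactly one representative. *)
Lemma double_count (V : zmodType) (I J : finType) (A : pred I)
    (r : I -> J -> bool) (F : J -> V) :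
    (forall j, F j = 0 \/ exists2 i0, A i0 & forall i, A i ->
      r i j = (i == i0)) ->
  \sum_(i | A i) \sum_(j | r i j) F j = \sum_j F j.
Proof.
move=> H; rewrite (exchange_big_dep xpredT) //=; apply: eq_bigr => j _.
have [->|[i0 Ai0 ri]] := H j; first by rewrite big1.
by rewrite (big_pred1 i0) // => i; case: (boolP (A i)) => [/ri|] //= nA;
  apply/esym/negP => /eqP ii0; rewrite ii0 Ai0 in nA.
Qed.

(** Turns the weight 1/|Aut| of a graph into a weight common to all graphs, by spreading the term
    over the permutations that represent it. *)
Lemma scale_card (V : lmodType rat) (I : finType) (A : pred I) (m w : nat) (x :
  V) :
    (0 < #|A| * m)%N -> (#|A| * m = w)%N ->
  m%:R^-1 *: x = w%:R^-1 *: \sum_(i | A i) x.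
Proof.
move=> + <-; rewrite muln_gt0 -!(Num.Theory.ltr0n rat) => /andP[A0 m0].
rewrite sumr_const -scaler_nat scalerA natrM invfM mulrAC mulVf ?mul1r //.
by rewrite Num.Theory.lt0r_neq0.
Qed.

(** * From decorated graphs to permutations *)

Section Decorations.
Variables (R : realType) (g : lieAlgebra R) (n : nat).
Implicit Types (G : dgraph g) (T : topgraph n).

Lemma underlying_valency nv ne nt (D : gdata nv ne nt) T :
  decorated D -> underlying D T -> forall v, valency D v = 3%N.
Proof.
move=> okD [f [[f' fK f'K] _ fV]] v.
have [_ vP] := tg_partition T.
have /card_gt0P[h] : (0 < valency D v)%N.
  by case/and5P: okD => _ _ /forallP/(_ v)/(leq_trans _)->.
rewrite inE => /eqP hv; pose x := f' h.
have /forall_inP/(_ (pblock (tg_verts T) x)) : [forall B in tg_verts T,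
  #|B| == 3%N].
  by have /and4P[] := valP T.
rewrite pblock_mem ?(cover_partition vP) ?inE // => /(_ isT)/eqP <-.
rewrite /valency -[RHS](card_imset _ (can_inj fK)); apply: eq_card => h'.
rewrite -(f'K h') (mem_imset _ _ (can_inj fK)) inE mem_pblockT // fV.
by rewrite /x !f'K hv eq_sym.
Qed.

Lemma sum_valency nv ne nt (D : gdata nv ne nt) : (\sum_v valency D v = ne *
  2)%N.
Proof.
rewrite -[ne in RHS]card_ord -card_bool -card_prod -sum1_card.
rewrite (partition_big (hend D) xpredT) //=; apply: eq_bigr => v _.
by rewrite sum1dep_card.
Qed.

Lemma underlying_sizes nv ne nt (D : gdata nv ne nt) T :
  decorated D -> underlying D T ->
    [/\ ne = (3 * n)%N, nv = (2 * n)%N & nt = nv].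
Proof.
move=> okD und; have val3 := underlying_valency okD und.
have neE : ne = (3 * n)%N.
  have [f [fbij _ _]] := und.
  by have := bij_eq_card fbij; rewrite card_ord card_prod card_ord card_bool;
    lia.
split=> //.
  have := sum_valency D; rewrite (eq_bigr (fun=> 3%N)) => [|v _];
    last exact: val3.
  by rewrite sum_nat_const card_ord neE; lia.
rewrite -[nt]card_ord -sum1_card (partition_big (own D) xpredT) //=.
rewrite -[RHS]card_ord -sum1_card; apply: eq_bigr => v _; rewrite sum1dep_card.
case/and5P: (okD) => _ _ _ _ /and3P[_ _ /forallP/(_ v)].
by rewrite val3 -[3%N]/(1 + 2)%N eqn_add2r => /eqP/esym ->.
Qed.

(** Replaces the sizes hidden in [G] by explicit ones, so that its data can be compared with
    [triv s]. *)
Lemma decorates_data G T : decorates G T ->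
  exists (D : gdata (2 * n) (3 * n) (2 * n)) (okD : decorated D),
    [/\ G = DGraph g okD, compatible D & underlying D T].
Proof.
case: G => [[[[nv ne] nt] D] ok]; move: D ok; rewrite /= => D ok [].
rewrite -[dg_data _]/D -[dg_nv _]/nv -[dg_ne _]/ne -[dg_nt _]/nt => comp und.
have [neE nvE ntE] := underlying_sizes ok und.
subst nt; subst nv; subst ne.
by exists D, ok.
Qed.

Local Notation triv := (triv (@slot n) (@unslot n)).

Section Representing.
Variables (D : gdata (2 * n) (3 * n) (2 * n)) (T : topgraph n).
Hypotheses (okD : decorated D) (compD : compatible D) (und : underlying D T).

Let valD := underlying_valency okD und.

Lemma trivalent_perm_framed : exists f, framed T (trivalent_perm okD valD) f.
Proof.
have [f [fbij fe fv]] := und; exists (finfun f); apply/framedP.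
split=> x y; rewrite !ffunE; first exact: (bij_inj fbij).
  exact: fe.
by rewrite !slot_trivalent_perm !own_leaf_slot //; exact: fv.
Qed.

(** Passing from a frame of [s0] to a frame of [s] is a permutation [p] preserving edges. Solving
    [p * s = s0 * u] for [u] gives one preserving vertices, and the sign of [s0] is [or_sign D]. *)
Lemma represents_isomorphic s : represents T s ->
  isomorphic D (triv s) (or_sign D * (-1) ^+ s).
Proof.
case/existsP=> f /framedP[fi fe fv].
have [f0 /framedP[f0i f0e f0v]] := trivalent_perm_framed.
have [f' fK f'K] := frame_inv fi; have [f0' f0K f0'K] := frame_inv f0i.
pose s0 := trivalent_perm okD valD.
have pinj : injective (fun h => f (f0' h)) by move=> h h' /fi/(can_inj f0'K).
pose p := perm pinj.
have pE h : p h = f (f0' h) by rewrite permE.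
rewrite (or_sign_trivalent_perm okD compD valD) -[X in isomorphic _ _ X]mul1r.
apply: isomorphic_trans (isomorphic_trivalent_perm okD valD) _.
apply: (isomorphic_triv (@slotK n) (@unslotK n) (p := p) (u := (s0^-1 * p *
  s)%g)).
- by move=> h h'; rewrite !pE -fe f0e !f0'K.
- move=> h h'; rewrite !permM -{2}(permKV s0 h) -{2}(permKV s0 h').
  move: ((s0^-1)%g h) ((s0^-1)%g h') => k k'.
  by rewrite !pE -fv f0v !f0'K.
- by rewrite !mulgA mulgV mul1g.
Qed.

End Representing.

Lemma represents_dsum loops G T s : decorates G T -> represents T s ->
  gc_eq ((-1) ^+ s *: dsum g loops (triv s))
        (or_sign (dg_data G) *: dsum g loops (dg_data G)).
Proof.
move=> /decorates_data[D [okD [-> comp und]]] Ts; rewrite /dg_data /=.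
have iso := represents_isomorphic okD comp und Ts.
apply: gc_eq_sym; apply: gc_eq_trans (gc_eqZ _ (isomorphic_dsum g loops okD
  iso)) _.
rewrite gc_scalerA /or_sign mulrA -expr2 sqrr_sign mul1r.
exact: gc_eq_refl.
Qed.

Lemma decorates_represents G T : decorates G T -> exists s, represents T s.
Proof.
move=> /decorates_data[D [okD [_ comp und]]].
have [f Tf] := trivalent_perm_framed okD und.
by exists (trivalent_perm okD (underlying_valency okD und)); apply/existsP;
  exists f.
Qed.

Lemma signed_dsum_ideal loops :
  gc_ideal (\sum_(s : {perm halfedge (3 * n)}) (-1) ^+ s *: dsum g loops (triv
    s)).
Proof.
have -> : \sum_(s : {perm halfedge (3 * n)}) (-1) ^+ s *: dsum g loops (triv s)
  =
    \sum_(e < 3 * n) \sum_(s : {perm halfedge (3 * n)}) (-1) ^+ s *: dterm g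
      loops (triv s) e.
  rewrite exchange_big; apply: eq_bigr => s _; exact: scaler_sumr.
apply: gc_ideal_sum => e _.
exact: (dterm_sum_ideal (@slotK n) (@unslotK n)).
Qed.

Lemma representatives_ideal loops (Gamma : topgraph n -> dgraph g)
    (X : {set topgraph n}) :
    (forall T, tg_connected T -> decorates (Gamma T) T) ->
    iso_representatives X [set T | tg_connected T && (loops || ~~ tg_self_loop
      T)] ->
  gc_ideal (\sum_(T in X) (#|tg_aut T|%:R)^-1 *:
    (or_sign (dg_data (Gamma T)) *: dsum g loops (dg_data (Gamma T)))).
Proof.
move=> decT Xrep.
have XP T : T \in X -> tg_connected T.
  case/and3P: Xrep => _ /subsetP sX _ /sX; rewrite inE => /andP[] //.
(* By the orbit count, |Aut T| times the number of permutations representing [T] is this [w] for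
   every [T] in [X]. *)
pose w := (#|edge_perms n| * #|slot_perms n|)%N.
pose F (s : {perm halfedge (3 * n)}) := (-1) ^+ s *: dsum g loops (triv s).
pose c T := or_sign (dg_data (Gamma T)) *: dsum g loops (dg_data (Gamma T)).
have scaleE T : T \in X -> gc_eq (#|tg_aut T|%:R^-1 *: c T)
    (w%:R^-1 *: \sum_(s | represents T s) F s).
  move=> /XP/decT dT; have [s Ts] := decorates_represents dT.
  have cardE : (#|represents T| * #|tg_aut T| = w)%N.
    rewrite /w -(card_represents Ts); congr (_ * _)%N.
    by apply: eq_card => s'; rewrite inE.
  have card_pos : (0 < #|represents T| * #|tg_aut T|)%N.
    rewrite muln_gt0; apply/andP; split; apply/card_gt0P; first by exists s.
    by exists 1%g; rewrite inE; apply/tg_carriesP; split=> x y; rewrite !perm1.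
  rewrite (scale_card _ card_pos cardE).
  apply: gc_eqZ; apply: gc_eq_sum => s' Ts'; apply: gc_eq_sym.
  exact: (represents_dsum loops dT Ts').
apply: (@gc_eq_ideal _ _ _
  (\sum_(T in X) w%:R^-1 *: (\sum_(s | represents T s) F s))).
  exact: gc_eq_sum.
rewrite -scaler_sumr; apply: gc_idealZ.
rewrite (double_count (A := mem X) (r := fun T s => represents T s)) => [|s].
  exact: signed_dsum_ideal.
have [/andP[conn loopD]|nok] :=
    boolP (gconnected (triv s) && (loops || ~~ has_loop (triv s))); last first.
  by left; rewrite /F (dsum_triv0 _ (@slotK n) (@unslotK n) nok) gc_scaler0.
have [T Ts] := topgraph_of_perm s; right.
have TP : T \in [set T | tg_connected T && (loops || ~~ tg_self_loop T)].
  rewrite inE (represents_connected Ts conn) /=.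
  by case/orP: loopD => [->//|/(contra (represents_self_loop Ts)) ->];
    rewrite orbT.
have [T0 T0X T0E] := iso_representativesP Xrep TP.
exists T0 => // T1 T1X; rewrite -T0E //; apply/idP/idP.
  exact: represents_iso.
by move/iso_represents; apply.
Qed.

End Decorations.

Section Cocycle.
Variables (R : realType) (g : lieAlgebra R) (n : nat).
Implicit Types (G : dgraph g).

Lemma delta_graphE G : delta_graph G = dsum g true (dg_data G).
Proof.
pose D := dg_data G.
rewrite /delta_graph /dsum (bigID (fun e => ~~ self_loop D e)) /=.
rewrite [X in _ + X]big1 ?addr0 => [|e]; last by rewrite negbK; exact: dterm0.
transitivity (\sum_(e : {e | ~~ self_loop D e}) dterm g true D (val e)).
  apply: eq_bigr => e _; rewrite (dtermE _ _ (valP e)) /=.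
  by rewrite (gen_decorated g (decorated_contract (valP e) (dg_ok G))).
exact: esym (big_sub [pred e | ~~ self_loop D e] (fun e => dterm g true D e)).
Qed.

Lemma unit_word : mkmalgU (FMonom [::]) 1 = 1 :> GCfree g.
Proof. by rewrite -fmoneE. Qed.

Lemma delta_word1 G : delta_word (fmonom_val (fmu G)) = delta_graph G.
Proof.
rewrite fmuE -[LHS]/(delta_graph G * mkmalgU (FMonom [::]) 1 +
  ((-1) ^+ `|dg_deg G|%N) *: (gc_gen G * 0)).
by rewrite unit_word mulr1 mulr0 gc_scaler0 addr0.
Qed.

Lemma delta_gens (I : finType) (P : pred I) (c : I -> rat) (F : I -> dgraph g) :
  delta (\sum_(i | P i) c i *: gc_gen (F i)) =
  \sum_(i | P i) c i *: dsum g true (dg_data (F i)).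
Proof.
rewrite [LHS](linear_ext_sum (fun m : {fmonom dgraph g} =>
  delta_word (fmonom_val m)) P c (fun i => fmu (F i))).
by apply: eq_bigr => i _; rewrite delta_word1 delta_graphE.
Qed.

Lemma word_ordU G : word_ord (fmu G) = dg_ord G.
Proof. by rewrite /word_ord fmuE big_seq1. Qed.

Lemma word_degU G : word_deg (fmu G) = dg_deg G.
Proof. by rewrite /word_deg fmuE big_seq1. Qed.

Lemma word_has_loopU G : word_has_loop (fmu G) = dg_has_loop G.
Proof. by rewrite /word_has_loop fmuE /= orbF. Qed.

Lemma msupp_gen G m : m \in msupp (gc_gen G) -> m = fmu G.
Proof. by move/(fsubsetP msuppU_le); rewrite in_fset1 => /eqP. Qed.

(** What remains are the contractions with a self-loop. Losing one edge and one vertex changes the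
    degree by -2 + 3 and keeps the order. *)
Lemma loop_part nv ne nt (D : gdata nv ne nt) m :
    m \in msupp (dsum g true D - dsum g false D) ->
  [/\ word_ord m = ne%:Z - nv%:Z, word_deg m = 2 * ne%:Z - 3 * nv%:Z + 1 &
      word_has_loop m].
Proof.
have -> : dsum g true D - dsum g false D =
    \sum_e (dterm g true D e - dterm g false D e) by exact: esym (sumrB _ _ _
      _).
move: m; apply: msupp_sum => e _ m.
have [De|he] := boolP (self_loop D e).
  by rewrite !dterm0 // subrr msupp0.
rewrite !(dtermE _ _ he) /=.
case: (boolP (has_loop (contract he))) => [loopC|_];
  last by rewrite subrr msupp0.
rewrite /= subr0 => /msupp_scale.
have [okC|nokC] := boolP (decorated (contract he)); last first.
  by rewrite gen_not_decorated // msupp0.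
rewrite (gen_decorated g okC) => /msupp_gen ->.
rewrite word_ordU word_degU word_has_loopU.
have := ltn_ord e; have := ltn_ord (src D e).
by split; [rewrite /dg_ord /dg_ne /dg_nv /=; lia |
  rewrite /dg_deg /dg_ne /dg_nv /=; lia | exact: loopC].
Qed.

End Cocycle.

Theorem proposition4p6p6 (R : realType) (g : lieAlgebra R) (Hg : semisimple g)
    (n : nat) (hn : (1 <= n)%N)
    (Gamma : topgraph n -> dgraph g)
    (HGamma : forall T : topgraph n, tg_connected T -> decorates (Gamma T) T) :
  (forall X : {set topgraph n},
     iso_representatives X [set T | tg_connected T] ->
     in_H0 n (\sum_(T in X) (#|tg_aut T|%:R)^-1 *: Psi (Gamma T)))
  /\
  (forall X : {set topgraph n},
     iso_representatives X [set T | tg_connected T && ~~ tg_self_loop T] ->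
     in_H0_sharp n (\sum_(T in X) (#|tg_aut T|%:R)^-1 *: Psi (Gamma T))).
Proof.
have homog (X : {set topgraph n}) : (forall T, T \in X -> tg_connected T) ->
    gc_homog n 0 (\sum_(T in X) (#|tg_aut T|%:R)^-1 *: Psi (Gamma T)).
  move=> conn; rewrite /gc_homog; apply: msupp_sum => T /conn/HGamma decT m.
  move/msupp_scale/msupp_scale/msupp_gen ->; rewrite word_ordU word_degU.
  have [D [okD [-> _ _]]] := decorates_data decT.
  by rewrite /dg_ord /dg_deg /dg_ne /dg_nv /=; lia.
have deltaE (X : {set topgraph n}) :
    delta (\sum_(T in X) (#|tg_aut T|%:R)^-1 *: Psi (Gamma T)) =
    \sum_(T in X) (#|tg_aut T|%:R)^-1 *:
      (or_sign (dg_data (Gamma T)) *: dsum g true (dg_data (Gamma T))).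
  pose c T := (#|tg_aut T|%:R)^-1 * or_sign (dg_data (Gamma T)).
  transitivity (delta (\sum_(T in X) c T *: gc_gen (Gamma T))).
    apply: (congr1 (@delta R g)); apply: eq_bigr => T _; exact: gc_scalerA.
  rewrite delta_gens; apply: eq_bigr => T _; exact: esym (gc_scalerA _ _ _).
split=> X Xrep.
  have conn T : T \in X -> tg_connected T.
    by case/and3P: Xrep => _ /subsetP sX _ /sX; rewrite inE.
  split; first exact: homog.
  rewrite deltaE; apply: (representatives_ideal (loops := true)) => //.
  by rewrite (_ : [set T | _] = [set T | tg_connected T]) //; apply/setP => T;
    rewrite !inE andbT.
have conn T : T \in X -> tg_connected T.
  by case/and3P: Xrep => _ /subsetP sX _ /sX; rewrite inE => /andP[].
split; first exact: homog.
(* The part of the differential with self-loops lies in the subcomplex; after subtracting it, the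
   truncated differential remains. *)
pose y := \sum_(T in X) (#|tg_aut T|%:R)^-1 *: (or_sign (dg_data (Gamma T)) *:
  (dsum g true (dg_data (Gamma T)) - dsum g false (dg_data (Gamma T)))).
exists y.
  have suppy m : m \in msupp y ->
      [/\ word_ord m = n%:Z, word_deg m = 1 & word_has_loop m].
    move: m; apply: msupp_sum => T /conn/HGamma decT m.
    have [D [okD [-> _ _]]] := decorates_data decT.
    move=> /msupp_scale/msupp_scale/loop_part[-> -> ->].
    by split=> //; rewrite /dg_ne /dg_nv /=; lia.
  by split=> m /suppy[].
rewrite deltaE -sumrB.
rewrite (eq_bigr (fun T =>
  (#|tg_aut T|%:R)^-1 *: (or_sign (dg_data (Gamma T)) *:
  dsum g false (dg_data (Gamma T))))).
  exact: representatives_ideal.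
by move=> T _; rewrite -!scalerBr opprB addrCA subrr addr0.
Qed.
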